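(* There exists an absolute constant $C>0$ (independent of $\sigma,\rho>0$ and of the solution) such that the following holds. Let $(E,\psi,W,\gamma,\lambda)$ be a solution of the bubble ring problem \begin{align*} -\nabla\cdot\left(\tfrac1r\nabla\psi\right)&=0 &&\text{in }\mathbb{R}^2_+\setminus\overline E,\\ \psi-\tfrac W2 r^2&=\gamma &&\text{on }\partial E,\\ 2\sigma H-\rho\left(\tfrac1r\partial_n\psi-W\,n\cdot e_r\right)^2+\lambda&=0 &&\text{on }\partial E,\\ \psi&=0 &&\text{on }\partial\mathbb{R}^2_+,\\ \psi&\to0 &&\text{as }|(r,z)|\to\infty, \end{align*} where the cross-section $E\subset\mathbb{R}^2_+$ is convex and symmetric under $z\mapsto -z$. Suppose that $$\int_{\partial E}H\,\mathrm{d}s\le 0$$ and that $\Psi:=\psi-\tfrac W2r^2$ satisfies $\partial_n\Psi\le 0$ on $\partial E$. Then $$\mathrm{We}\ \ge\ \frac{C}{\mu+\mu^3}\left(\frac1{\mu^2}+\delta\right),\qquad \mu:=\frac{R}{\sqrt{|E|}}.$$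
   Context: $\mathbb{R}^2_+=\{(r,z): r>0,\ z\in\mathbb{R}\}$, $\nabla=(\partial_r,\partial_z)^T$, $\nabla\cdot F=\partial_rF_r+\partial_zF_z$, and $e_r=(1,0)$. The set $E$ is the cross-section of an axisymmetric toroidal bubble: a bounded convex set with nonempty interior, with $\overline E\subset\mathbb{R}^2_+$, with $C^2$ boundary, and symmetric in the sense that $(r,z)\in E\iff(r,-z)\in E$. $n$ is the unit normal on $\partial E$ pointing into the exterior $\mathbb{R}^2_+\setminus\overline E$; $\partial_n$ is the derivative in direction $n$ taken from the exterior; $\mathrm{d}s$ is arc length; $|E|$ is the area of $E$. The quantity $H=\kappa+\frac{n\cdot e_r}{r}$ on $\partial E$ is (twice) the mean curvature of the ring, where $\kappa$ is the curvature of the planar curve $\partial E$, with the sign such that $\kappa\ge0$ for convex sets. $\sigma>0$ (surface tension) and $\rho>0$ (density) are given constants; $W,\gamma,\lambda\in\mathbb{R}$ are unknown constants that are part of the solution. Solutions $\psi:\mathbb{R}^2_+\setminus E\to\mathbb{R}$ are classical: $C^2$ in $\mathbb{R}^2_+\setminus\overline E$, $C^1$ up to $\partial E$, continuous up to $\{r=0\}$. The circulation is $\beta=-\int_{\partial E}\frac1r\partial_n\psi\,\mathrm{d}s$, the Weber number is $\mathrm{We}=\frac{\sqrt{2\pi}\,\rho\,\beta^2}{\sigma\sqrt{|E|}}$, the major radius is $R=\frac1{|E|}\int_E r\,\mathrm{d}(r,z)$, and $\delta=\int_E\frac1{r^2}\,\mathrm{d}(r,z)-2\pi$. *)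

(* Defs.v *)
From HB Require Import structures.
From mathcomp Require Import all_boot all_order all_algebra.
From mathcomp Require Import all_classical all_reals all_analysis.

Set Implicit Arguments.
Unset Strict Implicit.
Unset Printing Implicit Defensive.

Import Order.TTheory GRing.Theory Num.Theory.
Import numFieldNormedType.Exports.

Local Open Scope classical_set_scope.
Local Open Scope ring_scope.

(* Points of the plane are pairs x = (r, z): x.1 is r and x.2 is z. *)

Definition e_r (R : realType) : R * R := (1, 0).
Definition e_z (R : realType) : R * R := (0, 1).

Definition dot (R : realType) (x y : R * R) : R := x.1 * y.1 + x.2 * y.2.

(* The library norm on R * R is the maximum norm; this is the Euclidean one. *)
Definition enorm (R : realType) (x : R * R) : R := Num.sqrt (dot x x).

Definition boundary (R : realType) (E : set (R * R)) : set (R * R) :=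
  closure E `\` E°.

Definition area (R : realType) (E : set (R * R)) : R :=
  fine ((lebesgue_measure \x lebesgue_measure)%E E).

Definition plane_integral (R : realType) (E : set (R * R)) (f : R * R -> R) : R :=
  \int[(lebesgue_measure \x lebesgue_measure)%E]_(x in E) f x.

(* The tangent of a positively oriented arc-length parametrization, rotated
   clockwise by a right angle. *)
Definition normal (R : realType) (c : R -> R * R) (s : R) : R * R :=
  ((derive1 c s).2, - (derive1 c s).1).

(* c is an arc-length parametrization of the simple closed C^2 curve bounding
   E, of length L; the last clause fixes the orientation by requiring
   [normal c] to point to the exterior of E. *)
Record boundary_param (R : realType) (E : set (R * R)) (c : R -> R * R) (L : R)
    : Prop := BoundaryParam {
  bp_length_gt0 : 0 < L ;
  bp_derivable : forall s : R, derivable c s 1 ;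
  bp_derivable2 : forall s : R, derivable (derive1 c) s 1 ;
  bp_continuous2 : continuous (derive1n 2 c) ;
  bp_periodic : forall s : R, c (s + L) = c s ;
  bp_unit_speed : forall s : R, enorm (derive1 c s) = 1 ;
  bp_injective : forall s t : R, 0 <= s < L -> 0 <= t < L -> c s = c t -> s = t ;
  bp_range : range c = boundary E ;
  bp_outward : forall s : R,
    \forall h \near (0 : R)^'+, ~ closure E (c s + h *: normal c s)
}.

(* The integral with respect to arc length of a function on the boundary,
   given as a function of the arc-length parameter. *)
Definition line_integral (R : realType) (L : R) (f : R -> R) : R :=
  \int[lebesgue_measure]_(s in `[0, L]) f s.

(* For the positive orientation this is nonnegative when E is convex: one has
   c'' = - curvature * normal. *)
Definition curvature (R : realType) (c : R -> R * R) (s : R) : R :=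
  (derive1 c s).1 * (derive1n 2 c s).2 - (derive1 c s).2 * (derive1n 2 c s).1.

Definition ring_curvature (R : realType) (c : R -> R * R) (s : R) : R :=
  curvature c s + dot (normal c s) (e_r R) / (c s).1.

Record cross_section (R : realType) (E : set (R * R)) : Prop := CrossSection {
  cs_bounded : bounded_set E ;
  cs_convex : convex_set E ;
  cs_interior : E° !=set0 ;
  cs_half_plane : closure E `<=` [set x | 0 < x.1] ;
  cs_symmetric : forall r z, E (r, z) <-> E (r, - z)
}.

Definition exterior (R : realType) (E : set (R * R)) : set (R * R) :=
  [set x | 0 < x.1] `\` closure E.

Definition C1_on (R : realType) (U : set (R * R)) (f : R * R -> R) : Prop :=
  forall x, U x ->
    [/\ derivable f x (e_r R), derivable f x (e_z R),
        {for x, continuous f}, {for x, continuous ('D_(e_r R) f)}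
      & {for x, continuous ('D_(e_z R) f)}].

Definition C2_on (R : realType) (U : set (R * R)) (f : R * R -> R) : Prop :=
  [/\ C1_on U f, C1_on U ('D_(e_r R) f) & C1_on U ('D_(e_z R) f)].

(* Functions on the half-plane minus E are represented by total functions whose
   values elsewhere are irrelevant.  The last clause says that the gradient on
   the exterior extends continuously up to the boundary of E. *)
Record classical_regularity (R : realType) (E : set (R * R)) (psi : R * R -> R)
    : Prop := ClassicalRegularity {
  cr_C2 : C2_on (exterior E) psi ;
  cr_continuous : {within [set x | 0 <= x.1] `\` E°, continuous psi} ;
  cr_C1 : exists G : R * R -> R * R,
    {within [set x | 0 < x.1] `\` E°, continuous G} /\
    (forall x, exterior E x -> G x = ('D_(e_r R) psi x, 'D_(e_z R) psi x))
}.

(* - div ((1 / r) grad psi) *)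
Definition neg_div_grad (R : realType) (psi : R * R -> R) (x : R * R) : R :=
  - ('D_(e_r R) (fun y : R * R => y.1^-1 * 'D_(e_r R) psi y) x
   + 'D_(e_z R) (fun y : R * R => y.1^-1 * 'D_(e_z R) psi y) x).

(* The one-sided derivative in direction n; for n the outward normal the
   difference quotients only involve values from the exterior. *)
Definition ext_deriv (R : realType) (f : R * R -> R) (x n : R * R) : R :=
  lim (h^-1 * (f (x + h *: n) - f x) @[h --> (0 : R)^'+]).

Definition normal_deriv (R : realType) (c : R -> R * R) (f : R * R -> R)
    (s : R) : R := ext_deriv f (c s) (normal c s).

Record bubble_ring (R : realType) (sigma rho : R) (E : set (R * R))
    (c : R -> R * R) (psi : R * R -> R) (W gamma lambda : R) : Prop := BubbleRing {
  br_regular : classical_regularity E psi ;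
  br_pde : forall x, exterior E x -> neg_div_grad psi x = 0 ;
  br_dirichlet : forall x, boundary E x -> psi x - W / 2 * x.1 ^+ 2 = gamma ;
  br_dynamic : forall s : R,
    2 * sigma * ring_curvature c s
    - rho * ((c s).1^-1 * normal_deriv c psi s
             - W * dot (normal c s) (e_r R)) ^+ 2
    + lambda = 0 ;
  br_axis : forall z, psi (0, z) = 0 ;
  br_infinity : forall eps : R, 0 < eps -> exists M : R, forall x,
    exterior E x -> M < enorm x -> `|psi x| < eps
}.

Definition relative_stream (R : realType) (W : R) (psi : R * R -> R)
    (x : R * R) : R := psi x - W / 2 * x.1 ^+ 2.

Definition circulation (R : realType) (c : R -> R * R) (L : R)
    (psi : R * R -> R) : R :=
  - line_integral L (fun s => (c s).1^-1 * normal_deriv c psi s).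

Definition weber (R : realType) (sigma rho : R) (E : set (R * R))
    (c : R -> R * R) (L : R) (psi : R * R -> R) : R :=
  Num.sqrt (2 * pi) * rho * circulation c L psi ^+ 2
  / (sigma * Num.sqrt (area E)).

Definition major_radius (R : realType) (E : set (R * R)) : R :=
  (area E)^-1 * plane_integral E (fun x => x.1).

Definition delta (R : realType) (E : set (R * R)) : R :=
  plane_integral E (fun x => (x.1 ^+ 2)^-1) - 2 * pi.

Definition aspect (R : realType) (E : set (R * R)) : R :=
  major_radius E / Num.sqrt (area E).

(* Main.v *)
(* Put q = (1/r) d_n Psi <= 0, so that rho q^2 = 2 sigma H + lambda and, since
   n.e_r has integral zero over the boundary, the circulation is the integral of
   |q|.  Convexity gives kappa >= 0 with total 2 pi, half of it on the outer arc
   {n.e_r >= 0}; Green's theorem for e_r / r turns the integral of H into - delta.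
   Integrating the dynamic condition yields
     lambda L = 2 sigma delta + rho int q^2 >= 2 sigma (delta + pi),
   because rho q^2 >= 2 sigma kappa on the outer arc.  There also
   |q| >= sqrt (lambda / rho), so the circulation is at least sqrt (lambda / rho)
   times the height h of E, whence rho beta^2 >= 2 sigma (delta + pi) h^2 / L.
   With w the width of E one has L <= 2 (w + h), |E| <= w h and R >= w / 32,
   which bounds h^2 / (L sqrt |E|) below in terms of mu, while Jensen's inequality
   for 1 / r^2 gives delta + 2 pi >= 1 / mu^2.  The potential psi enters only
   through the dynamic condition on the boundary of E. *)
Require Import Defs.
From mathcomp Require Import all_boot all_order all_algebra.
From mathcomp Require Import all_classical all_reals all_analysis.
From mathcomp Require Import measurable_realfun ring lra.

Set Implicit Arguments.
Unset Strict Implicit.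
Unset Printing Implicit Defensive.

Import Order.TTheory GRing.Theory Num.Theory.
Import numFieldNormedType.Exports.

Local Open Scope classical_set_scope.
Local Open Scope ring_scope.


(** * One-variable calculus: increments compared through derivatives *)

Section calculus.
Context {R : realType}.
Implicit Types (f df g F : R -> R) (a b s : R).

(** Convexity enters through supporting lines: E lies behind every tangent line of its boundary, and
    this yields the sign of the curvature, the extreme points and the slices of E without the Jordan
    curve theorem or a lifted angle. With the symmetry it splits the loop into four arcs on which
    both components of the tangent keep their sign. Integrals over the loop become increments of
    primitives, so that each estimate on an arc is a comparison of derivatives. On the outer arcs
    |q| >= sqrt (lambda / rho) because both terms of H are nonnegative there, and these arcs
    together are at least as long as E is high. Everywhere |r'| + |z'| >= 1, whence the bound on L.
    The bound on R comes from the triangle spanned by the left, right and top extreme points. Two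
    obstacles remain. The normal derivative is a bare limit, so its existence must be drawn from the
    regularity of psi before the W term can be split off. And q is continuous because its sign
    resolves the square in the dynamic condition, which makes q minus the square root of a
    continuous function of the curve. *)

Lemma is_derive_continuous f (d : R) s : is_derive s 1 f d ->
  {for s, continuous f}.
Proof. by move=> [/derivable1_diffP/differentiable_continuous]. Qed.

Lemma is_derive_MVT f df a b : a <= b ->
  (forall s, a <= s <= b -> is_derive s 1 f (df s)) ->
  exists2 s, a <= s <= b & f b - f a = df s * (b - a).
Proof.
move=> ab fdf; have [s||s sab fs] := @MVT_segment R f df a b ab.
- by rewrite in_itv/= => /andP[as_ sb]; apply: fdf; rewrite !ltW.
- apply: continuous_in_subspaceT => s; rewrite inE/= in_itv/= => /fdf.
  exact: is_derive_continuous.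
by exists s => //; move: sab; rewrite in_itv.
Qed.

Lemma derive_ge0_le f df a b : a <= b ->
  (forall s, a <= s <= b -> is_derive s 1 f (df s)) ->
  (forall s, a <= s <= b -> 0 <= df s) -> f a <= f b.
Proof.
move=> ab fdf df0; have [s sab fs] := is_derive_MVT ab fdf.
by rewrite -subr_ge0 fs mulr_ge0 ?df0 ?subr_ge0.
Qed.

Lemma derive_le f df g dg a b : a <= b ->
  (forall s, a <= s <= b -> is_derive s 1 f (df s)) ->
  (forall s, a <= s <= b -> is_derive s 1 g (dg s)) ->
  (forall s, a <= s <= b -> df s <= dg s) -> f b - f a <= g b - g a.
Proof.
move=> ab fdf gdg dfg.
suff : (g - f) a <= (g - f) b by rewrite !fctE; lra.
apply: (@derive_ge0_le _ (fun s => dg s - df s)) => // s sab.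
  by have := fdf _ sab; have := gdg _ sab; move=> ? ?; exact: is_deriveB.
by rewrite subr_ge0 dfg.
Qed.

Lemma derive_eq f df g dg a b : a <= b ->
  (forall s, a <= s <= b -> is_derive s 1 f (df s)) ->
  (forall s, a <= s <= b -> is_derive s 1 g (dg s)) ->
  (forall s, a <= s <= b -> df s = dg s) -> f b - f a = g b - g a.
Proof.
move=> ab fdf gdg dfg; apply/eqP; rewrite eq_le.
by rewrite (derive_le ab fdf gdg) ?(derive_le ab gdg fdf) // => s /dfg->.
Qed.

Lemma continuous_integrable f a b : continuous f ->
  (@lebesgue_measure R).-integrable `[a, b] (EFin \o f).
Proof.
move=> cf; apply: continuous_compact_integrable; first exact: segment_compact.
exact: continuous_subspaceT.
Qed.

(** Periodicity gives F (s + L) - F s zero derivative, so the loop may be traversed from any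
    parameter; later it starts at the rightmost point. *)
Lemma line_integral_primitive f L : 0 < L -> continuous f ->
  (forall s, f (s + L) = f s) ->
  exists F, [/\ forall s, 0 <= s -> is_derive s 1 F (f s),
    line_integral L f = F L - F 0
    & forall s, 0 <= s -> line_integral L f = F (s + L) - F s].
Proof.
move=> L0 cf pf.
(* The base point -1 lies strictly to the left of 0, so that the fundamental theorem also applies at
   s = 0. *)
pose F s := \int[@lebesgue_measure R]_(t in `[-1, s]) f t.
have dF s : 0 <= s -> is_derive s 1 F (f s).
  move=> s0; have s1 : s < s + 1 by rewrite ltrDl.
  have N1s : -1 < s by rewrite (lt_le_trans _ s0)// ltrN10.
  have [|dFs Fs] := continuous_FTC1_closed s1 _ N1s (cf s).
    exact: continuous_integrable.
  apply: DeriveDef; first exact: dFs.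
  by rewrite -derive1E; exact: Fs.
have FL : line_integral L f = F L - F 0.
  rewrite /F (@Rintegral_itvB _ f (BLeft (-1)) (BRight L) 0) //=.
  - rewrite /line_integral Rintegral_itv_obnd_cbnd//.
    apply: integrableS (continuous_integrable 0 L cf) => //.
    exact: subset_itv_oc_cc.
  - exact: continuous_integrable.
  - by rewrite bnd_simp; lra.
  - by rewrite bnd_simp ltW.
exists F; split => // s s0; rewrite FL.
suff : (F (s + L) - F s) - (F (0 + L) - F 0) = 0 by rewrite add0r; lra.
have [s' s's|t _ ->] := @is_derive_MVT (fun s => F (s + L) - F s)
  (fun s => f (s + L) - f s) 0 s s0; last by rewrite pf subrr mul0r.
have s'0 : 0 <= s' by case/andP: s's.
apply: is_deriveB; last exact: dF.
have := @is_derive1_comp R F (fun s => s + L) s' (f (s' + L)) 1.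
rewrite mulr1; apply; first by apply: dF; rewrite addr_ge0// ltW.
by apply: is_derive_eq; rewrite addr0.
Qed.

End calculus.


(** * Closures of convex plane sets and their supporting lines *)

Section plane.
Context {R : realType}.
Implicit Types (c : R -> R * R) (s : R) (E : set (R * R)).

Lemma is_derive_fst c s : derivable c s 1 ->
  is_derive s 1 (fun s => (c s).1) (derive1 c s).1.
Proof.
move=> dc.
have H : h^-1 *: ((c (h *: (1:R) + s)).1 - (c s).1) @[h --> (0:R)^'] --> (derive1 c s).1.
  rewrite derive1E.
  exact: (continuous_cvg _ cvg_fst dc).
by apply: DeriveDef; [apply/cvg_ex; exists (derive1 c s).1|exact: cvg_lim H].
Qed.

Lemma is_derive_snd c s : derivable c s 1 ->
  is_derive s 1 (fun s => (c s).2) (derive1 c s).2.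
Proof.
move=> dc.
have H : h^-1 *: ((c (h *: (1:R) + s)).2 - (c s).2) @[h --> (0:R)^'] --> (derive1 c s).2.
  rewrite derive1E.
  exact: (continuous_cvg _ cvg_snd dc).
by apply: DeriveDef; [apply/cvg_ex; exists (derive1 c s).2|exact: cvg_lim H].
Qed.

(** Convexity unfolded to coordinates with plain real weights, so that concrete combinations reduce
    to field identities. *)
Definition plane_convex E := forall p q t, E p -> E q -> 0 <= t <= 1 ->
  E (t * p.1 + (1 - t) * q.1, t * p.2 + (1 - t) * q.2).

Lemma convex_set_plane E : convex_set E -> plane_convex E.
Proof.
move=> cE p q t Ep Eq t01.
have [t0 t1] := andP t01.
have k01 : (0 <= t <= 1)%R by [].
have := cE p q (Itv01 t0 t1); rewrite !inE => /(_ Ep Eq).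
by congr E.
Qed.

Lemma plane_closure E p : closure E p <-> forall e, 0 < e -> exists q,
  [/\ E q, `|p.1 - q.1| < e & `|p.2 - q.2| < e].
Proof.
split=> [Ep e e0|H].
  have [q [Eq [/= q1 q2]]] := Ep _ (nbhsx_ballx p e e0).
  by exists q.
move=> B /nbhs_ballP[e /= e0 pB].
have [q [Eq q1 q2]] := H e e0.
by exists q; split => //; apply: pB; split.
Qed.

Lemma ltr_norm_conv (t a b e : R) : 0 <= t <= 1 -> `|a| < e -> `|b| < e ->
  `|t * a + (1 - t) * b| < e.
Proof.
move=> /andP[t0 t1] ae be; rewrite (le_lt_trans (ler_normD _ _))// !normrM.
rewrite (ger0_norm t0) (@ger0_norm _ (1 - t)) ?subr_ge0//.
have [->|tn0] := eqVneq t 0; first by rewrite mul0r add0r subr0 mul1r.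
have tp : 0 < t by rewrite lt_neqAle eq_sym tn0.
have : t * `|a| < t * e by rewrite ltr_pM2l.
have : (1 - t) * `|b| <= (1 - t) * e by rewrite ler_wpM2l ?subr_ge0// ltW.
lra.
Qed.

Lemma plane_convex_closure E : plane_convex E -> plane_convex (closure E).
Proof.
move=> cE p q t /plane_closure Kp /plane_closure Kq /andP[t0 t1].
apply/plane_closure => e e0 /=.
have [p' [Ep' p1 p2]] := Kp e e0; have [q' [Eq' q1 q2]] := Kq e e0.
exists (t * p'.1 + (1 - t) * q'.1, t * p'.2 + (1 - t) * q'.2) => /=.
have t01 : 0 <= t <= 1 by rewrite t0.
split; [exact: cE| |].
- rewrite (_ : _ - _ = t * (p.1 - p'.1) + (1 - t) * (q.1 - q'.1)); last by ring.
  exact: ltr_norm_conv.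
- rewrite (_ : _ - _ = t * (p.2 - p'.2) + (1 - t) * (q.2 - q'.2)); last by ring.
  exact: ltr_norm_conv.
Qed.

(** With both weights at most 1/2, the point is the midpoint of o + 2x (p - o) and o + 2y (q - o),
    which lie on two sides of the triangle. *)
Lemma plane_convex_triangle K o p q x y : plane_convex K -> K o -> K p -> K q ->
  0 <= x <= 2^-1 -> 0 <= y <= 2^-1 ->
  K (o.1 + x * (p.1 - o.1) + y * (q.1 - o.1),
     o.2 + x * (p.2 - o.2) + y * (q.2 - o.2)).
Proof.
move=> cK Ko Kp Kq /andP[x0 x1] /andP[y0 y1].
have hx : 0 <= 2 * x <= 1 by lra.
have hy : 0 <= 2 * y <= 1 by lra.
have h2 : 0 <= (2^-1 : R) <= 1 by lra.
have := cK _ _ _ (cK _ _ _ Kp Ko hx) (cK _ _ _ Kq Ko hy) h2.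
by congr K; rewrite /=; congr pair; field.
Qed.

Lemma is_derive_approx (f : R -> R) s (d e : R) : is_derive s 1 f d -> 0 < e ->
  exists2 r, 0 < r & forall h, `|h| < r -> `|f (s + h) - f s - d * h| <= e * `|h|.
Proof.
move=> [df fd] e0.
have : h^-1 *: (f (h *: (1 : R) + s) - f s) @[h --> (0 : R)^'] --> d.
  by rewrite -fd; exact: df.
move=> /cvgrPdist_le/(_ e e0)/nbhs_ballP[r /= r0 hr].
exists r => // h hr'.
have [->|h0] := eqVneq h 0; first by rewrite addr0 mulr0 subr0 subrr !normr0 mulr0.
have /= := hr h; rewrite /ball/= sub0r normrN => /(_ hr' h0).
rewrite /GRing.scale/= mulr1 (addrC h s) => H.
rewrite distrC (_ : d * h - _ = (d - h^-1 * (f (s + h) - f s)) * h); last by field.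
by rewrite normrM ler_wpM2r.
Qed.

(* If p were in front of the tangent line at [c s], the triangle spanned by
   [c s], p and a nearby point of the curve would contain [c s + h *: n] for
   all small h > 0. *)
Lemma closure_support E c L s p : cross_section E -> boundary_param E c L ->
  closure E p -> dot (normal c s) (p - c s) <= 0.
Proof.
move=> HE Hc Kp; rewrite leNgt; apply/negP.
have cK := plane_convex_closure (convex_set_plane (cs_convex HE)).
have Kc t : closure E (c t).
  have : boundary E (c t) by rewrite -(bp_range Hc); exists t.
  by case.
have := bp_unit_speed Hc s.
have := @bp_outward _ _ _ _ Hc s; rewrite /normal /enorm /dot /=.
have := is_derive_fst (@bp_derivable _ _ _ _ Hc s).
have := is_derive_snd (@bp_derivable _ _ _ _ Hc s).
set x1 := (derive1 c s).1; set y1 := (derive1 c s).2 => dy dx out unit alpha0.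
have {}unit : x1 * x1 + y1 * y1 = 1.
  have h0 : 0 <= x1 * x1 + y1 * y1 by nra.
  by rewrite -[LHS]sqr_sqrtr// unit expr1n.
set alpha := (X in 0 < X) in alpha0.
pose beta := x1 * (p.1 - (c s).1) + y1 * (p.2 - (c s).2).
have pE1 : p.1 - (c s).1 = alpha * y1 + beta * x1.
  have -> : p.1 - (c s).1 = (p.1 - (c s).1) * (x1 * x1 + y1 * y1).
    by rewrite unit mulr1.
  by rewrite /alpha /beta; ring.
have pE2 : p.2 - (c s).2 = - alpha * x1 + beta * y1.
  have -> : p.2 - (c s).2 = (p.2 - (c s).2) * (x1 * x1 + y1 * y1).
    by rewrite unit mulr1.
  by rewrite /alpha /beta; ring.
pose vT t := x1 * ((c t).1 - (c s).1) + y1 * ((c t).2 - (c s).2).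
pose vn t := y1 * ((c t).1 - (c s).1) - x1 * ((c t).2 - (c s).2).
(* In the frame at [c s], [alpha] and [beta] are the normal and tangential components of p - c s,
   [vn] and [vT] those of c t - c s. To first order the curve moves along its tangent, so a small
   step against the sign of [beta] makes [vn] negligible beside [vT]. *)
have [t [tT tn]] : exists t, beta * vT t <= 0 /\ `|beta * vn t| < alpha * `|vT t|.
  have dvT : is_derive s 1 vT 1.
    by rewrite /vT; apply: is_derive_eq; rewrite -unit /GRing.scale/=; ring.
  have dvn : is_derive s 1 vn 0.
    by rewrite /vn; apply: is_derive_eq; rewrite /GRing.scale/=; ring.
  have vTs : vT s = 0 by rewrite /vT !subrr !mulr0 addr0.
  have vns : vn s = 0 by rewrite /vn !subrr !mulr0 subr0.
  have b1 : 0 < `|beta| + 1 by rewrite ltr_wpDl.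
  have e0 : 0 < alpha / (4 * (`|beta| + 1)) by rewrite divr_gt0// mulr_gt0.
  have h2 : 0 < 2^-1 :> R by lra.
  have [d1 d10 hT] := is_derive_approx dvT h2.
  have [d2 d20 hn] := is_derive_approx dvn e0.
  have [h [h0 hd1 hd2 bh]] : exists h, [/\ h != 0, `|h| < d1, `|h| < d2 & beta * h <= 0].
    have d0 : 0 < Num.min d1 d2 / 2 by rewrite divr_gt0// lt_min d10.
    have dd : Num.min d1 d2 / 2 < Num.min d1 d2 by lra.
    move: (dd); rewrite lt_min => /andP[dd1 dd2].
    have [b0|b0] := leP 0 beta.
      exists (- (Num.min d1 d2 / 2)); rewrite oppr_eq0 normrN gtr0_norm// gt_eqF//.
      by split => //; nra.
    by exists (Num.min d1 d2 / 2); rewrite gtr0_norm// gt_eqF//; split => //; nra.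
  exists (s + h).
  have := hT _ hd1; have := hn _ hd2; rewrite vTs vns !subr0 mul1r mul0r subr0.
  have nh : 0 < `|h| by rewrite normr_gt0.
  move=> hvn hvT; split.
    move: hvT; rewrite ler_norml => /andP[hv1 hv2].
    have [hp|hn'] := leP 0 h.
      by move: hv1 hv2; rewrite ger0_norm//; nra.
    by move: hv1 hv2; rewrite ltr0_norm//; nra.
  have vTh : `|h| / 2 <= `|vT (s + h)|.
    have := ler_normB (vT (s + h)) (vT (s + h) - h); rewrite subKr; lra.
  rewrite normrM (@le_lt_trans _ _ (`|beta| * (alpha / (4 * (`|beta| + 1)) * `|h|)))//.
    by rewrite ler_wpM2l.
  rewrite (@lt_le_trans _ _ (alpha * (`|h| / 2)))//; last by rewrite ler_wpM2l// ltW.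
  have bn0 : `|beta| + 1 != 0 by rewrite gt_eqF.
  have -> : `|beta| * (alpha / (4 * (`|beta| + 1)) * `|h|) =
      alpha * `|h| * (`|beta| / (4 * (`|beta| + 1))) by field.
  rewrite (mulrA alpha _ 2^-1) ltr_pM2l ?mulr_gt0// ltr_pdivrMr ?mulr_gt0//.
  by have := normr_ge0 beta; lra.
have vT0 : vT t != 0.
  by apply/eqP => h; move: tn; rewrite h normr0 mulr0 normr_lt0.
(* Solving h n = u (p - c s) + v (c t - c s) in this frame gives u = h / D and v = - h beta / (D
   vT); the choice of t makes D > 0 and v >= 0, and both weights are at most 1/2 for small h. *)
pose D := alpha - beta * vn t / vT t.
have D0 : 0 < D.
  rewrite subr_gt0 (le_lt_trans (ler_norm _))// normrM normfV.
  by rewrite ltr_pdivrMr ?normr_gt0.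
have : \forall h \near (0 : R)^'+, closure E (c s + h *: (y1, - x1)).
  have B0 : 0 < Num.min (D / 2) (D * `|vT t| / (2 * (`|beta| + 1))).
    have b1 : 0 < `|beta| + 1 by rewrite ltr_wpDl.
    have D2 : 0 < D / 2 by lra.
    by rewrite lt_min D2/= divr_gt0// mulr_gt0// normr_gt0.
  near=> h.
  have h0 : 0 < h by [].
  have : h < Num.min (D / 2) (D * `|vT t| / (2 * (`|beta| + 1))).
    by near: h; exact: nbhs_right_lt.
  rewrite lt_min => /andP[hD hb].
  have x01 : 0 <= h / D <= 2^-1.
    apply/andP; split; first by rewrite divr_ge0// ltW.
    by rewrite ler_pdivrMr//; lra.
  have y01 : 0 <= - (h / D * beta / vT t) <= 2^-1.
    apply/andP; split.
      rewrite -mulrA -mulrN mulr_ge0 ?divr_ge0 ?(ltW D0) ?(ltW h0)// oppr_ge0.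
      have : beta / vT t = beta * vT t / (vT t) ^+ 2 by field.
      by move=> ->; rewrite mulr_le0_ge0// invr_ge0 sqr_ge0.
    rewrite (le_trans (ler_norm _))// normrN !normrM !normfV.
    rewrite (gtr0_norm h0) (gtr0_norm D0).
    rewrite ler_pdivrMr ?normr_gt0// mulrAC ler_pdivrMr//.
    move: hb; rewrite ltr_pdivlMr ?mulr_gt0 ?ltr_wpDl//.
    by have := normr_ge0 beta; nra.
  have := plane_convex_triangle cK (Kc s) Kp (Kc t) x01 y01.
  congr (closure E _); rewrite pE1 pE2.
  have e1 : (c t).1 - (c s).1 = vT t * x1 + vn t * y1.
    by rewrite -[LHS]mulr1 -unit /vT /vn; ring.
  have e2 : (c t).2 - (c s).2 = vT t * y1 - vn t * x1.
    by rewrite -[LHS]mulr1 -unit /vT /vn; ring.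
  have aD : alpha = D + beta * vn t / vT t by rewrite /D subrK.
  have Dn0 : D != 0 by rewrite gt_eqF.
  rewrite e1 e2 aD; clearbody D vT vn.
  by congr pair => /=; rewrite ?/GRing.scale/=; field; rewrite vT0 Dn0.
move=> ink; near (0 : R)^'+ => h.
suff : ~ closure E (c s + h *: (y1, - x1)) by apply; near: h.
by near: h.
Unshelve. all: by end_near. Qed.
End plane.


(* (x, y) is the arc-length parametrization, (x1, y1) its unit tangent, k the
   curvature, so that (y1, - x1) is the outer normal and [cl_support] says that
   E lies behind each of its tangent lines. *)
Record convex_loop (R : realType) (E : set (R * R)) (x y x1 y1 k : R -> R)
    (L : R) : Prop := ConvexLoop {
  cl_length : 0 < L ;
  cl_dx : forall s : R, is_derive s (1 : R) x (x1 s) ;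
  cl_dy : forall s : R, is_derive s (1 : R) y (y1 s) ;
  cl_dx1 : forall s : R, is_derive s (1 : R) x1 (- y1 s * k s) ;
  cl_dy1 : forall s : R, is_derive s (1 : R) y1 (x1 s * k s) ;
  cl_k : continuous k ;
  cl_unit : forall s : R, x1 s ^+ 2 + y1 s ^+ 2 = 1 ;
  cl_xL : forall s, x (s + L) = x s ;
  cl_yL : forall s, y (s + L) = y s ;
  cl_inj : forall s t : R, 0 <= s < L -> 0 <= t < L -> x s = x t -> y s = y t ->
    s = t ;
  cl_convex : plane_convex (closure E) ;
  cl_sym : forall r z, closure E (r, z) -> closure E (r, - z) ;
  cl_half : forall p, closure E p -> 0 < p.1 ;
  cl_support : forall s p, closure E p ->
    y1 s * (p.1 - x s) - x1 s * (p.2 - y s) <= 0 ;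
  cl_mem : forall s, closure E (x s, y s) ;
  cl_boundary : forall p, closure E p ->
    (exists s, p = (x s, y s)) \/ E° p ;
  cl_interior : E° !=set0 }.

(** * From the boundary parametrization to scalar functions *)

Section of_boundary_param.
Context {R : realType}.
Implicit Types (c : R -> R * R) (s : R) (E : set (R * R)).

Lemma ring_curvatureE c s : ring_curvature c s =
  curvature c s + (derive1 c s).2 / (c s).1.
Proof. by rewrite /ring_curvature /dot /normal /e_r /= mulr1 mulr0 addr0. Qed.

(** The Frenet equations: differentiating u^2 + v^2 = 1 makes (du, dv) orthogonal to (u, v), hence a
    multiple of (- v, u). *)
Lemma unit_speed_frame (u v du dv : R -> R) :
  (forall s : R, is_derive s (1 : R) u (du s)) ->
  (forall s : R, is_derive s (1 : R) v (dv s)) ->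
  (forall s : R, u s ^+ 2 + v s ^+ 2 = 1) ->
  forall s, du s = - v s * (u s * dv s - v s * du s) /\
    dv s = u s * (u s * dv s - v s * du s).
Proof.
move=> udu vdv unit s.
have orth : u s * du s + v s * dv s = 0.
  have : is_derive s 1 (fun s => u s ^+ 2 + v s ^+ 2) (2 * (u s * du s + v s * dv s)).
    have us := udu s; have vs := vdv s.
    by apply: is_derive_eq; rewrite /GRing.scale/=; ring.
  rewrite (_ : (fun s => _) = cst 1); last by apply/funext => t; rewrite unit.
  by move=> [_]; rewrite derive_cst => /esym/eqP; rewrite mulf_eq0 pnatr_eq0 => /eqP.
have := unit s; move: (u s) (v s) (du s) (dv s) orth => a b a' b' orth ab.
split.
  transitivity ((a ^+ 2 + b ^+ 2) * a'); first by rewrite ab mul1r.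
  transitivity (a * (a * a' + b * b') - b * (a * b' - b * a')); first by ring.
  by rewrite orth mulr0 sub0r mulNr.
transitivity ((a ^+ 2 + b ^+ 2) * b'); first by rewrite ab mul1r.
transitivity (b * (a * a' + b * b') + a * (a * b' - b * a')); first by ring.
by rewrite orth mulr0 add0r.
Qed.

Lemma boundary_param_loop E c L : cross_section E -> boundary_param E c L ->
  convex_loop E (fun s => (c s).1) (fun s => (c s).2)
    (fun s => (derive1 c s).1) (fun s => (derive1 c s).2) (curvature c) L.
Proof.
move=> HE Hc.
have d1 s := @bp_derivable _ _ _ _ Hc s.
have d2 s := @bp_derivable2 _ _ _ _ Hc s.
have dx s := is_derive_fst (d1 s).
have dy s := is_derive_snd (d1 s).
have dx1 s := is_derive_fst (d2 s).
have dy1 s := is_derive_snd (d2 s).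
have unit s : (derive1 c s).1 ^+ 2 + (derive1 c s).2 ^+ 2 = 1.
  have := bp_unit_speed Hc s; rewrite /enorm /dot -!expr2 => u.
  by rewrite -[LHS]sqr_sqrtr ?u ?expr1n// addr_ge0// sqr_ge0.
have frame := unit_speed_frame dx1 dy1 unit.
have Kc t : boundary E (c t) by rewrite -(bp_range Hc); exists t.
split => //.
- exact: bp_length_gt0 Hc.
- by move=> s; apply: (is_derive_eq (dx1 s)); have [e _] := frame s; exact: e.
- by move=> s; apply: (is_derive_eq (dy1 s)); have [_ e] := frame s; exact: e.
- move=> s.
  have c2 := @bp_continuous2 _ _ _ _ Hc s.
  apply: cvgB; apply: cvgM.
  + exact: is_derive_continuous (dx1 s).
  + exact: (continuous_cvg _ cvg_snd c2).
  + exact: is_derive_continuous (dy1 s).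
  + exact: (continuous_cvg _ cvg_fst c2).
- by move=> s; rewrite (bp_periodic Hc).
- by move=> s; rewrite (bp_periodic Hc).
- move=> s t s0 t0 h1 h2; apply: (bp_injective Hc) => //.
  by rewrite (surjective_pairing (c s)) h1 h2 -surjective_pairing.
- exact: plane_convex_closure (convex_set_plane (cs_convex HE)).
- move=> r z /plane_closure Kp; apply/plane_closure => e e0.
  have [[q1 q2] [/= Eq h1 h2]] := Kp e e0; exists (q1, - q2) => /=.
  have [sE _] := @cs_symmetric _ _ HE q1 q2.
  by split => //; [exact: sE|rewrite -opprD normrN].
- exact: cs_half_plane HE.
- move=> s p Kp; have := closure_support s HE Hc Kp.
  by rewrite /dot /normal/= mulNr.
- by move=> s; have [] := Kc s; rewrite -surjective_pairing.
- move=> p Kp; have [Ip|Ip] := pselect (E° p); [by right|left].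
  have : boundary E p by [].
  by rewrite -(bp_range Hc) => -[t _ <-]; exists t; rewrite -surjective_pairing.
- exact: cs_interior HE.
Qed.
End of_boundary_param.


(** * Periodic functions and the extreme points of the loop *)

Section periodic.
Context {R : realType}.
Implicit Types (f df : R -> R) (L s t : R).

Lemma periodicZ f L : (forall s, f (s + L) = f s) ->
  forall (n : int) s, f (s + L *~ n) = f s.
Proof.
move=> pf; have pn (n : nat) t : f (t + L *+ n) = f t.
  by elim: n t => [|n IH] t; rewrite ?mulr0n ?addr0// mulrS addrA IH pf.
case=> n t; first by rewrite -pmulrn pn.
by rewrite NegzE mulrNz -pmulrn -(pn n.+1 (t - _)) subrK.
Qed.

Lemma period_reduce L s : 0 < L -> exists n : int, 0 <= s + L *~ n < L.
Proof.
move=> L0; exists (- Num.floor (s / L)).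
have /andP[n1 n2] := floor_itv (s / L).
rewrite mulrNz -mulrzl subr_ge0 ltrBlDr.
move: n1 n2; rewrite ler_pdivlMr// ltr_pdivrMr// intrD mulrDl mul1r => -> /=.
by rewrite addrC.
Qed.

Lemma periodic_max f df L : 0 < L -> (forall s, is_derive s 1 f (df s)) ->
  (forall s, f (s + L) = f s) -> exists s, forall t, f t <= f s.
Proof.
move=> L0 fdf pf; have [|s _ smax] := @EVT_max R f 0 L (ltW L0).
  apply: continuous_subspaceT => s; exact: is_derive_continuous (fdf s).
exists s => t; have [n tL] := period_reduce t L0.
rewrite -(periodicZ pf n t); apply: smax; rewrite in_itv/=.
by case/andP: tL => -> /ltW.
Qed.

Lemma max_derive0 f df s : (forall t, is_derive t 1 f (df t)) ->
  (forall t, f t <= f s) -> df s = 0.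
Proof.
move=> fdf fmax; have fdt t : derivable f t 1 by have [] := fdf t.
have /= := @derive1_at_max R f (s - 1) (s + 1) s.
have [_ <-] := fdf s; case=> //.
- lra.
- by rewrite in_itv/=; lra.
Qed.

End periodic.

Section loop.
Context {R : realType} (E : set (R * R)) (x y x1 y1 k : R -> R) (L : R).
Hypothesis H : convex_loop E x y x1 y1 k L.
Implicit Types (s t : R).

Let L0 : 0 < L. Proof. exact: cl_length H. Qed.
Let dx := cl_dx H.
Let dy := cl_dy H.
Let unit := cl_unit H.
Let supp := @cl_support _ _ _ _ _ _ _ _ H.
Let mem := cl_mem H.

Lemma loop_reduce s : exists t, [/\ 0 <= t < L, x t = x s & y t = y s].
Proof.
have [n sn] := period_reduce s L0; exists (s + L *~ n).
by rewrite (periodicZ (cl_xL H)) (periodicZ (cl_yL H)).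
Qed.

Lemma loop_vertical s : x1 s = 0 -> y1 s = 1 \/ y1 s = -1.
Proof.
move=> x10; have := unit s; rewrite x10 expr0n/= add0r => /eqP.
by rewrite sqrf_eq1 => /orP[/eqP|/eqP]; [left|right].
Qed.

Lemma loop_horizontal s : y1 s = 0 -> x1 s = 1 \/ x1 s = -1.
Proof.
move=> y10; have := unit s; rewrite y10 expr0n/= addr0 => /eqP.
by rewrite sqrf_eq1 => /orP[/eqP|/eqP]; [left|right].
Qed.

(** Were x constant, x1 would vanish everywhere, while periodicity of y makes y1 vanish somewhere,
    against unit speed. *)
Lemma loop_x_extrema : exists s t, [/\ x t < x s, (forall u, x u <= x s)
  & (forall u, x t <= x u)].
Proof.
have [s smax] := periodic_max L0 dx (cl_xL H).
have dNx (u : R) : is_derive u (1 : R) (- x) (- x1 u) by have := dx u; exact: is_deriveN.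
have [|t tmin] := @periodic_max R (- x) (fun u => - x1 u) L L0 dNx.
  by move=> u; rewrite !fctE (cl_xL H).
have {}tmin u : x t <= x u by have := tmin u; rewrite !fctE lerN2.
exists s, t; split => //; rewrite lt_neqAle smax andbT; apply/eqP => ts.
have x10 u : x1 u = 0.
  by apply: (max_derive0 dx) => v; rewrite (le_trans (smax v))// -ts.
have [u _] : exists2 u, 0 <= u <= L & y L - y 0 = y1 u * (L - 0).
  by apply: is_derive_MVT => [|u _]; [exact: ltW|exact: dy].
rewrite -[L in y L]add0r (cl_yL H) subrr subr0 => /esym/eqP.
rewrite mulf_eq0 (gt_eqF L0) orbF => /eqP y10.
by have := unit u; rewrite x10 y10 expr0n addr0 => /esym/eqP; rewrite oner_eq0.
Qed.

(** By symmetry and convexity the closure has axis points at the extreme values of x. Such a point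
    is not interior, since a small horizontal shift would leave the range of x, so the curve passes
    through it. *)
Lemma loop_bounds : exists a b, [/\ 0 < a < b,
  (forall p, closure E p -> a <= p.1 <= b),
  closure E (a, 0), closure E (b, 0) & exists s t,
  [/\ x s = b, y s = 0, x t = a & y t = 0]].
Proof.
have [s [t [ts smax tmin]]] := loop_x_extrema.
have xs0 : x1 s = 0 by exact: max_derive0 smax.
have xt0 : x1 t = 0.
  apply/eqP; rewrite -oppr_eq0; apply/eqP.
  apply: (@max_derive0 R (- x) (- x1)) => u; last by rewrite !fctE lerN2.
  by have := dx u; exact: is_deriveN.
have ys1 : y1 s = 1.
  case: (loop_vertical xs0) => // ys.
  by have := supp s (@mem t); rewrite /= xs0 ys; lra.
have yt1 : y1 t = -1.
  case: (loop_vertical xt0) => // yt.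
  by have := supp t (@mem s); rewrite /= xt0 yt; lra.
have Kab p : closure E p -> x t <= p.1 <= x s.
  move=> Kp; have := supp s Kp; have := supp t Kp.
  by rewrite xs0 xt0 ys1 yt1 !mul0r !subr0 mul1r; lra.
have axis u : closure E (x u, 0).
  have h2 : 0 <= (2^-1 : R) <= 1 by lra.
  have := cl_convex H (@mem u) (cl_sym H (@mem u)) h2.
  by congr (closure E (_, _)) => /=; field.
have on_curve u : (forall p, closure E p -> p.1 <= x u) \/
    (forall p, closure E p -> x u <= p.1) -> exists v, x v = x u /\ y v = 0.
  move=> hu; have [[v [-> ->]]|] := cl_boundary H (axis u); first by exists v.
  move=> /nbhs_ballP[e /= e0 hE].
  have Kball r : `|x u - r| < e -> closure E (r, 0).
    by move=> re; apply/subset_closure/hE; split=> //=; rewrite /ball/= subrr normr0.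
  have e2 : 0 < e / 2 by lra.
  case: hu => hu.
    have := hu (x u + e / 2, 0) (Kball _ _); rewrite /= opprD addNKr normrN gtr0_norm//.
    by lra.
  have := hu (x u - e / 2, 0) (Kball _ _); rewrite /= opprB addrC subrK gtr0_norm//.
  by lra.
exists (x t), (x s); split.
- by rewrite ts andbT; exact: (cl_half H (@mem t)).
- exact: Kab.
- exact: axis.
- exact: axis.
have [|s' [xs' ys']] := on_curve s; first by left=> p /Kab/andP[].
have [|t' [xt' yt']] := on_curve t; first by right=> p /Kab/andP[].
by exists s', t'.
Qed.

(* The tangent line at (x, y) has the mirror image (x, - y) behind it. *)
Lemma loop_mirror s : x1 s * y s <= 0.
Proof. by have := supp s (cl_sym H (@mem s)); rewrite /= subrr mulr0; lra. Qed.

End loop.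


(** * Division of the loop into four monotone arcs *)

Lemma continuous_zero (R : realType) (f : R -> R) (s t : R) : continuous f ->
  s <= t -> f s * f t <= 0 -> exists2 u, s <= u <= t & f u = 0.
Proof.
move=> cf st fst.
have [||u] := @IVT R f s t 0 st; first exact: continuous_subspaceT.
  rewrite ge_min le_max.
  have [fs|fs] := leP (f s) 0; have [ft|ft] := leP 0 (f t) => //=; nra.
by rewrite in_itv/= => su fu; exists u.
Qed.

Lemma derive_periodic (R : realType) (f df : R -> R) (L s : R) :
  (forall t : R, is_derive t (1 : R) f (df t)) ->
  (forall t, f (t + L) = f t) -> df (s + L) = df s.
Proof.
move=> fdf pf; have dsh : is_derive s (1 : R) (fun t => t + L) 1.
  by apply: is_derive_eq; rewrite addr0.
have := @is_derive1_comp R f (fun t => t + L) s (df (s + L)) 1 (fdf (s + L)) dsh.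
rewrite mulr1 (_ : f \o _ = f); last by apply/funext => t; rewrite /= pf.
by move=> [_ <-]; have [_ <-] := fdf s.
Qed.

(* [s0], [m], [s1], [m'] are the parameters of the right, top, left and bottom
   extreme points, met in this order; the normal has a nonnegative [e_r]
   component on the arcs I and IV. *)
Record loop_quadrants (R : realType) (E : set (R * R)) (x y x1 y1 : R -> R)
    (L a b Z s0 m s1 m' : R) : Prop := LoopQuadrants {
  lq_ab : 0 < a < b ;
  lq_Z : 0 < Z ;
  lq_order : [/\ 0 <= s0, s0 < m, m < s1, s1 < m' & m' < s0 + L] ;
  lq_range : forall p, closure E p -> (a <= p.1 <= b) && (- Z <= p.2 <= Z) ;
  lq_a : closure E (a, 0) ;
  lq_b : closure E (b, 0) ;
  lq_s0 : [/\ x s0 = b, y s0 = 0, x1 s0 = 0 & y1 s0 = 1] ;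
  lq_m : [/\ y m = Z, x1 m = -1 & y1 m = 0] ;
  lq_s1 : [/\ x s1 = a, y s1 = 0, x1 s1 = 0 & y1 s1 = -1] ;
  lq_m' : [/\ y m' = - Z, x1 m' = 1 & y1 m' = 0] ;
  lq_I : forall s, s0 <= s <= m -> (x1 s <= 0) && (0 <= y1 s) ;
  lq_II : forall s, m <= s <= s1 -> (x1 s <= 0) && (y1 s <= 0) ;
  lq_III : forall s, s1 <= s <= m' -> (0 <= x1 s) && (y1 s <= 0) ;
  lq_IV : forall s, m' <= s <= s0 + L -> (0 <= x1 s) && (0 <= y1 s) ;
  lq_vertical : forall s, a < x s < b -> x1 s != 0 ;
  lq_axis : forall s, s0 <= s <= s1 -> 0 <= y s ;
  lq_axis' : forall s, s1 <= s <= s0 + L -> y s <= 0 }.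

Section loop.
Context {R : realType} (E : set (R * R)) (x y x1 y1 k : R -> R) (L : R).
Hypothesis H : convex_loop E x y x1 y1 k L.
Implicit Types (s t : R).

Let dx := cl_dx H.
Let dy := cl_dy H.
Let unit := cl_unit H.
Let supp := @cl_support _ _ _ _ _ _ _ _ H.
Let mem := cl_mem H.
Let cy : continuous y.
Proof. by move=> s; exact: is_derive_continuous (dy s). Qed.
Let cy1 : continuous y1.
Proof. by move=> s; exact: is_derive_continuous (cl_dy1 H s). Qed.
Let x1L s : x1 (s + L) = x1 s.
Proof. exact: derive_periodic dx (cl_xL H). Qed.
Let y1L s : y1 (s + L) = y1 s.
Proof. exact: derive_periodic dy (cl_yL H). Qed.


(** The signed height [g] of the curve over its tangent line at s is nonpositive and vanishes at s
    to first order, with second derivative - k s there; a negative k s would make [g] positive just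
    after s. *)
Lemma loop_curvature_ge0 s : 0 <= k s.
Proof.
rewrite leNgt; apply/negP => ks0.
pose g t := y1 s * (x t - x s) - x1 s * (y t - y s).
pose dg t := y1 s * x1 t - x1 s * y1 t.
have gdg (t : R) : is_derive t (1 : R) g (dg t).
  have := dx t; have := dy t => ? ?.
  by apply: is_derive_eq; rewrite /GRing.scale/= /dg; ring.
have dgdg : is_derive s (1 : R) dg (- k s).
  have := cl_dx1 H s; have := cl_dy1 H s => ? ?.
  apply: is_derive_eq; rewrite /GRing.scale/=.
  by rewrite -[RHS]mulr1 -(unit s); ring.
have dgs : dg s = 0 by rewrite /dg; ring.
have e0 : 0 < - k s / 2 by lra.
have [r r0 hr] := is_derive_approx dgdg e0.
have dg_gt0 h : 0 < h < r -> 0 < dg (s + h).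
  move=> /andP[h0 hlt]; have := hr h; rewrite gtr0_norm// => /(_ hlt).
  by rewrite dgs subr0 ler_norml; nra.
have r2 : s < s + r / 2 by rewrite ltrDl divr_gt0.
have cg : {within `[s, s + r / 2], continuous g}.
  by apply: continuous_subspaceT => t; exact: is_derive_continuous (gdg t).
have [t] := MVT r2 (fun t _ => gdg t) cg.
rewrite in_itv/= => /andP[st tr] gt.
have gs : g s = 0 by rewrite /g; ring.
have : g (s + r / 2) <= 0 by have := supp s (@mem (s + r / 2)).
have dgt : 0 < dg t by have := dg_gt0 (t - s); rewrite (addrC s) subrK; apply; lra.
have : 0 < dg t * (s + r / 2 - s) by apply: mulr_gt0 => //; lra.
by rewrite -gt gs; lra.
Qed.

(** If the axis itself were a tangent line, E would lie on one side of it and, being symmetric,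
    inside it, leaving no interior. *)
Lemma loop_horizontal_off_axis s a b : y1 s = 0 ->
  (forall p, closure E p -> a <= p.1 <= b) ->
  closure E (a, 0) -> closure E (b, 0) -> y s != 0.
Proof.
move=> y10 Kab Ka Kb; apply/eqP => ys0.
have p2 p : closure E p -> p.2 = 0.
  move=> Kp; have := supp s Kp.
  have := supp s (cl_sym H (_ : closure E (p.1, p.2))).
  rewrite -surjective_pairing => /(_ Kp) /=; rewrite y10 ys0 !mul0r !subr0.
  by case: (loop_horizontal H y10) => ->; lra.
have [q /nbhs_ballP[e /= e0 hE]] := cl_interior H.
have : closure E q by apply/subset_closure/hE; exact: ballxx.
move=> /p2 q2; have : closure E (q.1, q.2 + e / 2).
  apply/subset_closure/hE; split => /=; first exact: ballxx.
  by rewrite /ball/= opprD addNKr normrN gtr0_norm; lra.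
by move=> /p2 /=; lra.
Qed.

Lemma loop_inj_from s0 s t : 0 <= s0 < L -> s0 <= s < s0 + L ->
  s0 <= t < s0 + L -> x s = x t -> y s = y t -> s = t.
Proof.
have red u : 0 <= s0 < L -> s0 <= u < s0 + L ->
    exists v, [/\ 0 <= v < L, x v = x u, y v = y u & v = u \/ v = u - L].
  move=> s0L su; have [uL|Lu] := ltP u L.
    by exists u; split => //; [lra|left].
  exists (u - L); split; [lra| | |by right].
  - by rewrite -[in RHS](subrK L u) (cl_xL H).
  - by rewrite -[in RHS](subrK L u) (cl_yL H).
move=> s0L hs ht xst yst.
have [u [u0 xu yu us]] := red s s0L hs.
have [v [v0 xv yv vt]] := red t s0L ht.
have uv : u = v by apply: (cl_inj H) => //; rewrite ?xu ?yu ?xv ?yv.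
by case: us vt => us [] vt; lra.
Qed.

(** A tangent line at an axis point strictly between a and b has both (a, 0) and (b, 0) behind it,
    so it is the axis, which is excluded. Hence y vanishes only at the two extreme points, each met
    once per period. *)
Lemma loop_axis_points : exists a b s0 s1, [/\ 0 < a < b,
  (forall p, closure E p -> a <= p.1 <= b),
  closure E (a, 0), closure E (b, 0) & [/\ 0 <= s0 < L, s0 < s1 < s0 + L,
  [/\ x s0 = b, y s0 = 0, x s1 = a & y s1 = 0] &
  (forall s, s0 < s < s1 -> y s != 0) /\
  (forall s, s1 < s < s0 + L -> y s != 0)]].
Proof.
have [a [b [ab Kab Ka Kb [s [t [xs ys xt yt]]]]]] := loop_bounds H.
have [s0 [s0L xs0 ys0]] := loop_reduce H s.
have [t0 [t0L xt0 yt0]] := loop_reduce H t.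
have s0t0 : s0 != t0.
  by apply/eqP => e; move: ab; rewrite -xs -xt -xs0 -xt0 e ltxx andbF.
(* A shift by one period places the leftmost point after the rightmost one. *)
pose s1 := if s0 < t0 then t0 else t0 + L.
have s1L : s0 < s1 < s0 + L.
  by rewrite /s1; have [?|?|e] := ltgtP s0 t0; [lra|lra|rewrite e eqxx in s0t0].
have xs1 : x s1 = a.
  by rewrite /s1; case: ifP => _; rewrite ?(cl_xL H) xt0.
have ys1 : y s1 = 0.
  by rewrite /s1; case: ifP => _; rewrite ?(cl_yL H) yt0.
have zero u : y u = 0 -> x u = a \/ x u = b.
  move=> yu; have /andP[/= au ub] := Kab _ (@mem u).
  have [ua|au'] := leP (x u) a; first by left; apply/eqP; rewrite eq_le ua.
  have [bu|ub'] := leP b (x u); first by right; apply/eqP; rewrite eq_le ub.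
  have := supp u Ka; have := supp u Kb; rewrite /= yu subr0 mulr0 !subr0 => h1 h2.
  have y10 : y1 u = 0 by nra.
  by have := loop_horizontal_off_axis y10 Kab Ka Kb; rewrite yu eqxx.
have only u : s0 <= u < s0 + L -> y u = 0 -> u = s0 \/ u = s1.
  move=> hu yu; case: (zero u yu) => xu; [right|left].
    by apply: (loop_inj_from s0L); rewrite ?xu ?yu ?xs1 ?ys1//; lra.
  by apply: (loop_inj_from s0L); rewrite ?xu ?yu ?xs0 ?ys0//; lra.
exists a, b, s0, s1; split => //; split => //; first by split => //; congruence.
split => u hu; apply/eqP => yu.
  by have /only/(_ yu)[|] : s0 <= u < s0 + L; lra.
by have /only/(_ yu)[|] : s0 <= u < s0 + L; lra.
Qed.

(** Signs propagate: y1 = 1 at [s0] fixes the sign of y on both halves of the loop, [loop_mirror]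
    turns it into the sign of x1, and the curvature then makes y1 monotone on each half, so its
    zeros m and m' separate the arcs. *)
Lemma loop_quadrants_exist : exists a b Z s0 m s1 m',
  loop_quadrants E x y x1 y1 L a b Z s0 m s1 m'.
Proof.
have [a [b [s0 [s1 [ab Kab Ka Kb [s0L s1L [xs0 ys0 xs1 ys1] [yne yne']]]]]]] :=
  loop_axis_points.
have [_ ltab] := andP ab.
have xa s : a <= x s by have /andP[] := Kab _ (@mem s).
have xb s : x s <= b by have /andP[] := Kab _ (@mem s).
have xmax s : x s = b -> x1 s = 0 /\ y1 s = 1.
  move=> xs; have x10 : x1 s = 0 by apply: (max_derive0 dx) => t; rewrite xs.
  split=> //; case: (loop_vertical H x10) => // ys.
  by have := supp s Ka; rewrite /= x10 ys xs; lra.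
have xmin s : x s = a -> x1 s = 0 /\ y1 s = -1.
  move=> xs; have x10 : x1 s = 0.
    apply/eqP; rewrite -oppr_eq0; apply/eqP.
    apply: (@max_derive0 R (- x) (- x1)) => t; last by rewrite !fctE lerN2 xs.
    by have := dx t; exact: is_deriveN.
  split=> //; case: (loop_vertical H x10) => // ys.
  by have := supp s Kb; rewrite /= x10 ys xs; lra.
have [x1s0 y1s0] := xmax _ xs0; have [x1s1 y1s1] := xmin _ xs1.
have dys0 : is_derive s0 (1 : R) y 1 by have := dy s0; rewrite y1s0.
have h2 : 0 < 2^-1 :> R by lra.
have [r r0 hr] := is_derive_approx dys0 h2.
have ypos s : s0 < s < s1 -> 0 < y s.
  move=> hs; rewrite lt_neqAle eq_sym yne//= leNgt; apply/negP => ys.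
  pose h := Num.min (r / 2) (s - s0).
  have h0 : 0 < h by rewrite lt_min; lra.
  have hr' : h < r by rewrite gt_min; lra.
  have hs' : h <= s - s0 by rewrite ge_min lexx orbT.
  have yh : 0 < y (s0 + h).
    by have := hr h; rewrite gtr0_norm// => /(_ hr'); rewrite ys0 ler_norml; lra.
  have sh : s0 + h <= s by lra.
  have ys' : y (s0 + h) * y s <= 0 by nra.
  have [u hu yu] := continuous_zero cy sh ys'.
  have /yne : s0 < u < s1 by lra.
  by rewrite yu eqxx.
have yneg s : s1 < s < s0 + L -> y s < 0.
  move=> hs; rewrite lt_neqAle yne'//= leNgt; apply/negP => ys.
  pose h := Num.min (r / 2) (s0 + L - s).
  have h0 : 0 < h by rewrite lt_min; lra.
  have hr' : h < r by rewrite gt_min; lra.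
  have hs' : h <= s0 + L - s by rewrite ge_min lexx orbT.
  have yh : y (s0 + L - h) < 0.
    rewrite addrAC (cl_yL H).
    have := hr (- h); rewrite normrN gtr0_norm// => /(_ hr').
    by rewrite ys0 ler_norml; lra.
  have sh : s <= s0 + L - h by lra.
  have ys' : y s * y (s0 + L - h) <= 0 by nra.
  have [u hu yu] := continuous_zero cy sh ys'.
  have /yne' : s1 < u < s0 + L by lra.
  by rewrite yu eqxx.
have x1neg s : s0 <= s <= s1 -> x1 s <= 0.
  have [->|n0] := eqVneq s s0; first by rewrite x1s0.
  have [->|n1] := eqVneq s s1; first by rewrite x1s1.
  move=> hs; have := loop_mirror H s.
  by have : 0 < y s; [apply: ypos; lra|nra].
have x1pos s : s1 <= s <= s0 + L -> 0 <= x1 s.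
  have [->|n0] := eqVneq s (s0 + L); first by rewrite x1L x1s0.
  have [->|n1] := eqVneq s s1; first by rewrite x1s1.
  move=> hs; have := loop_mirror H s.
  by have : y s < 0; [apply: yneg; lra|nra].
have k0 := loop_curvature_ge0.
(* The curvature is nonnegative, so [y1' = x1 * k] has the sign of [x1]. *)
have y1decr s t : s0 <= s -> s <= t -> t <= s1 -> y1 t <= y1 s.
  move=> s0s st ts1; rewrite -lerN2.
  apply: (@derive_ge0_le R (- y1) (fun u => - (x1 u * k u)) s t st) => u ust.
    by have := cl_dy1 H u; exact: is_deriveN.
  by rewrite oppr_ge0 mulr_le0_ge0// x1neg//; lra.
have y1incr s t : s1 <= s -> s <= t -> t <= s0 + L -> y1 s <= y1 t.
  move=> s0s st ts1.
  apply: (derive_ge0_le st (fun u _ => cl_dy1 H u)) => u ust.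
  by rewrite mulr_ge0// x1pos//; lra.
have [m hm y1m] : exists2 m, s0 <= m <= s1 & y1 m = 0.
  by apply: continuous_zero => //; [lra|rewrite y1s0 y1s1; lra].
have [m' hm' y1m'] : exists2 m', s1 <= m' <= s0 + L & y1 m' = 0.
  by apply: continuous_zero => //; [lra|rewrite y1L y1s0 y1s1; lra].
have ms0 : m != s0 by apply/eqP => e; move: y1s0; rewrite -e y1m; lra.
have ms1 : m != s1 by apply/eqP => e; move: y1s1; rewrite -e y1m; lra.
have m's1 : m' != s1 by apply/eqP => e; move: y1s1; rewrite -e y1m'; lra.
have m's0 : m' != s0 + L.
  by apply/eqP => e; move: y1s0; rewrite -y1L -e y1m'; lra.
have x1m : x1 m = -1.
  by case: (loop_horizontal H y1m) => // e; have := x1neg _ hm; rewrite e; lra.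
have x1m' : x1 m' = 1.
  by case: (loop_horizontal H y1m') => // e; have := x1pos _ hm'; rewrite e; lra.
have Km p : closure E p -> p.2 <= y m.
  by move=> /(supp m); rewrite y1m x1m; lra.
have Km' p : closure E p -> y m' <= p.2.
  by move=> /(supp m'); rewrite y1m' x1m'; lra.
have ym' : y m' = - y m.
  have := Km _ (cl_sym H (@mem m')); have := Km' _ (cl_sym H (@mem m)) => /=.
  lra.
exists a, b, (y m), s0, m, s1, m'; split => //.
- by apply: ypos; lra.
- by split; lra.
- by move=> p Kp; rewrite Kab// -ym' Km// Km'.
- by move=> s hs; rewrite x1neg ?andTb -?y1m ?y1decr//; lra.
- by move=> s hs; rewrite x1neg ?andTb -?y1m ?y1decr//; lra.
- by move=> s hs; rewrite x1pos ?andTb -?y1m' ?y1incr//; lra.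
- by move=> s hs; rewrite x1pos ?andTb -?y1m' ?y1incr//; lra.
- move=> s hs; apply/eqP => x10; have := supp s Ka; have := supp s Kb.
  by rewrite x10 /=; case: (loop_vertical H x10) => ->; lra.
- move=> s hs; have [->|n0] := eqVneq s s0; first by rewrite ys0.
  have [->|n1] := eqVneq s s1; first by rewrite ys1.
  by apply/ltW/ypos; lra.
- move=> s hs; have [->|n0] := eqVneq s (s0 + L); first by rewrite (cl_yL H) ys0.
  have [->|n1] := eqVneq s s1; first by rewrite ys1.
  by apply/ltW/yneg; lra.
Qed.

End loop.


(** * Tangent angle, arc lengths and total curvature *)

Section angle.
Context {R : realType}.

(* With (x1, y1) = (cos th, sin th), [2 * atan (y1 / (x1 + e))] is [th] up to a
   constant, and it is smooth on the half circle where e * x1 >= 0; this avoids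
   lifting the tangent angle. *)
Lemma is_derive_half_angle (x1 y1 : R -> R) (k s e : R) : (e = 1 \/ e = -1) ->
  is_derive s (1 : R) x1 (- y1 s * k) -> is_derive s (1 : R) y1 (x1 s * k) ->
  x1 s ^+ 2 + y1 s ^+ 2 = 1 -> 0 <= e * x1 s ->
  is_derive s (1 : R) (fun t => 2 * atan (y1 t / (x1 t + e))) k.
Proof.
move=> e1 dx1 dy1 unit ex.
have e2 : e ^+ 2 = 1 by case: e1 => ->; ring.
have xe : x1 s + e != 0.
  apply/eqP => h; have : e * (x1 s + e) = 0 by rewrite h mulr0.
  by rewrite mulrDr -expr2 e2; lra.
have dxe : is_derive s (1 : R) (fun t => x1 t + e) (- y1 s * k).
  have := @is_deriveD R R R x1 (cst e) s 1 _ _ dx1 (is_derive_cst e s 1).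
  by rewrite addr0.
have dV := @is_deriveV R (fun t => x1 t + e) s (- y1 s * k) 1 xe dxe.
have du : is_derive s (1 : R) (fun t => y1 t / (x1 t + e)) (e * k / (x1 s + e)).
  have h := @is_deriveM R R y1 (fun t => (x1 t + e)^-1) s 1 _ _ dy1 dV.
  apply: (is_derive_eq h); rewrite /GRing.scale/=.
  move: (x1 s) (y1 s) unit xe => u v uv ue.
  transitivity (k * (u ^+ 2 + v ^+ 2 + u * e) / (u + e) ^+ 2); first by field.
  by rewrite uv -e2; field.
have da := @is_derive1_comp R atan (fun t => y1 t / (x1 t + e)) s _ _
  (is_derive1_atan _) du.
have h := @is_deriveZ R R R _ 2 s 1 _ da.
apply: (is_derive_eq h); rewrite /GRing.scale/=.
have e0 : e != 0 by case: e1 => ->; rewrite ?oppr_eq0 oner_eq0.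
move: (x1 s) (y1 s) unit xe => u v uv ue.
have -> : 1 + (v / (u + e)) ^+ 2 = 2 * e / (u + e).
  transitivity ((u ^+ 2 + v ^+ 2 + 2 * u * e + e ^+ 2) / (u + e) ^+ 2); first by field.
  have -> : u ^+ 2 + v ^+ 2 + 2 * u * e + e ^+ 2 = 2 * e * (u + e).
    by rewrite uv; have := e2; lra.
  by field.
by field; rewrite ue e0.
Qed.

End angle.

Section quadrants.
Context {R : realType} (E : set (R * R)) (x y x1 y1 k : R -> R) (L : R).
Hypothesis H : convex_loop E x y x1 y1 k L.
Context (a b Z s0 m s1 m' : R).
Hypothesis Q : loop_quadrants E x y x1 y1 L a b Z s0 m s1 m'.
Implicit Types (s t : R).

Let dx := cl_dx H.
Let dy := cl_dy H.
Let unit := cl_unit H.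

(** A unit tangent has |x1| + |y1| >= 1, and both components keep their sign on each arc, so an arc
    is no longer than its width plus its height. *)
Lemma loop_length : L <= 2 * (b - a) + 4 * Z.
Proof.
have [h0 h1 h2 h3 h4] := lq_order Q.
have [xs0 ys0 _ _] := lq_s0 Q; have [ym _ _] := lq_m Q.
have [xs1 ys1 _ _] := lq_s1 Q; have [ym' _ _] := lq_m' Q.
have did (s : R) : is_derive s (1 : R) id 1 by exact: is_derive_id.
have D (e e' : R) s :
    is_derive s (1 : R) (fun s => e * x s + e' * y s) (e * x1 s + e' * y1 s).
  have := dx s; have := dy s => ? ?; apply: is_derive_eq.
  by rewrite /GRing.scale/=; ring.
have u (p q : R) : p ^+ 2 + q ^+ 2 = 1 -> 0 <= p -> 0 <= q -> 1 <= p + q.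
  by move=> pq p0 q0; rewrite -[1]pq; nra.
have i1 : m - s0 <= (-1 * x m + 1 * y m) - (-1 * x s0 + 1 * y s0).
  apply: (derive_le (ltW h1) (fun s _ => did s) (fun s _ => D _ _ s)) => s /(lq_I Q).
  by move=> /andP[? ?]; apply: u; rewrite ?mul1r ?mulN1r ?sqrrN ?oppr_ge0.
have i2 : s1 - m <= (-1 * x s1 + -1 * y s1) - (-1 * x m + -1 * y m).
  apply: (derive_le (ltW h2) (fun s _ => did s) (fun s _ => D _ _ s)) => s /(lq_II Q).
  by move=> /andP[? ?]; apply: u; rewrite ?mul1r ?mulN1r ?sqrrN ?oppr_ge0.
have i3 : m' - s1 <= (1 * x m' + -1 * y m') - (1 * x s1 + -1 * y s1).
  apply: (derive_le (ltW h3) (fun s _ => did s) (fun s _ => D _ _ s)) => s /(lq_III Q).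
  by move=> /andP[? ?]; apply: u; rewrite ?mul1r ?mulN1r ?sqrrN ?oppr_ge0.
have i4 : s0 + L - m' <= (1 * x (s0 + L) + 1 * y (s0 + L)) - (1 * x m' + 1 * y m').
  apply: (derive_le (ltW h4) (fun s _ => did s) (fun s _ => D _ _ s)) => s /(lq_IV Q).
  by move=> /andP[? ?]; apply: u; rewrite ?mul1r ?mulN1r ?sqrrN ?oppr_ge0.
rewrite (cl_xL H) (cl_yL H) in i4; lra.
Qed.

(** Since y1 <= 1, climbing from the bottom to the top takes at least the height 2 Z in arc
    length. *)
Lemma loop_outer_length : 2 * Z <= (m - s0) + (s0 + L - m').
Proof.
have [h0 h1 h2 h3 h4] := lq_order Q.
have [xs0 ys0 _ _] := lq_s0 Q; have [ym _ _] := lq_m Q; have [ym' _ _] := lq_m' Q.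
have did (s : R) : is_derive s (1 : R) id 1 by exact: is_derive_id.
have y1le s : y1 s <= 1 by have := unit s; nra.
have i1 : y m - y s0 <= m - s0.
  exact: (derive_le (ltW h1) (fun s _ => dy s) (fun s _ => did s)).
have i2 : y (s0 + L) - y m' <= s0 + L - m'.
  exact: (derive_le (ltW h4) (fun s _ => dy s) (fun s _ => did s)).
rewrite (cl_yL H) in i2; lra.
Qed.

(** The tangent turns by pi / 2 on each arc. The half-angle primitive is taken with e = -1 on the
    upper half, where x1 <= 0, and with e = 1 on the lower half. *)
Lemma loop_curvature (F : R -> R) :
  (forall s, 0 <= s -> is_derive s (1 : R) F (k s)) ->
  [/\ F m - F s0 = pi / 2, F (s0 + L) - F m' = pi / 2 &
    F (s0 + L) - F s0 = 2 * pi].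
Proof.
move=> dF.
have [h0 h1 h2 h3 h4] := lq_order Q.
have [_ _ xs0 ys0] := lq_s0 Q; have [_ xm ym] := lq_m Q.
have [_ _ xs1 ys1] := lq_s1 Q; have [_ xm' ym'] := lq_m' Q.
have A (e : R) (s t : R) : 0 <= s <= t -> e = 1 \/ e = -1 ->
  (forall u, s <= u <= t -> 0 <= e * x1 u) ->
  F t - F s = 2 * atan (y1 t / (x1 t + e)) - 2 * atan (y1 s / (x1 s + e)).
  move=> /andP[s00 st] e1 ex.
  apply: (@derive_eq R F k (fun t => 2 * atan (y1 t / (x1 t + e))) k s t st) => // u su.
    by apply: dF; lra.
  exact: (is_derive_half_angle e1 (cl_dx1 H u) (cl_dy1 H u) (unit u) (ex u su)).
have o1 : (1 = 1 :> R \/ 1 = -1 :> R) by left.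
have o2 : (-1 = 1 :> R \/ -1 = -1 :> R) by right.
have [t1 t2 t3 t4] : [/\ 0 <= s0 <= m, 0 <= m <= s1, 0 <= s1 <= m' & 0 <= m' <= s0 + L].
  by split; lra.
have q1 u : s0 <= u <= m -> 0 <= -1 * x1 u by move=> /(lq_I Q)/andP[? ?]; lra.
have q2 u : m <= u <= s1 -> 0 <= -1 * x1 u by move=> /(lq_II Q)/andP[? ?]; lra.
have q3 u : s1 <= u <= m' -> 0 <= 1 * x1 u by move=> /(lq_III Q)/andP[? ?]; lra.
have q4 u : m' <= u <= s0 + L -> 0 <= 1 * x1 u by move=> /(lq_IV Q)/andP[? ?]; lra.
have B1 := A _ _ _ t1 o2 q1; have B2 := A _ _ _ t2 o2 q2.
have B3 := A _ _ _ t3 o1 q3; have B4 := A _ _ _ t4 o1 q4.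
have x1L : x1 (s0 + L) = x1 s0 by exact: derive_periodic dx (cl_xL H).
have y1L : y1 (s0 + L) = y1 s0 by exact: derive_periodic dy (cl_yL H).
move: B1 B2 B3 B4; rewrite x1L y1L xs0 xs1 xm xm' ys0 ys1 ym ym'.
rewrite !mul0r !add0r invrN invr1 ?divr1 ?mulN1r ?mulrN1 ?mul1r ?mulr1 ?opprK.
rewrite ?atanN ?atan0 ?atan1.
by move=> B1 B2 B3 B4; split; lra.
Qed.

End quadrants.


(** * Vertical slices of the section and Green's theorem *)

Lemma lebesgue_measure_segment_lty (R : realType) (c d : R) :
  ((@lebesgue_measure R) `[c, d] < +oo)%E.
Proof.
rewrite lebesgue_measure_itv/=.
by case: ifP => _; rewrite ?ltry// -EFinB ltry.
Qed.

Lemma Rintegral_cst_itv (R : realType) (v c d : R) (p q : bool) : c <= d ->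
  \int[@lebesgue_measure R]_(r in [set` Interval (BSide p c) (BSide q d)]) v =
  v * (d - c).
Proof.
move=> cd; rewrite Rintegral_cst; last exact: measurable_itv.
congr (_ * _); transitivity (fine (@lebesgue_measure R
  [set` Interval (BSide p c) (BSide q d)])); first by [].
rewrite lebesgue_measure_itv/= lte_fin.
by case: ltgtP cd => // -> _; rewrite subrr.
Qed.

(** For r strictly between the extremes, the slice of E over r is by symmetry the interval between
    minus and plus this height, up to its end points, which E may lack. *)
Definition half_slice (R : realType) (E : set (R * R)) (r : R) : R :=
  sup [set z | closure E (r, z)].

(** Replaces the chain rule where the outer function is only known to be Lipschitz but the inner
    derivative vanishes. *)
Lemma is_derive0_dominated (R : realType) (f g : R -> R) (s B : R) :
  is_derive s (1 : R) g 0 ->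
  (forall t, `|f t - f s| <= B * `|g t - g s|) -> is_derive s (1 : R) f 0.
Proof.
move=> dg fg.
have H : h^-1 *: (f (h *: (1 : R) + s) - f s) @[h --> (0 : R)^'] --> (0 : R).
  apply/cvgrPdist_le => e e0.
  have B1 : 0 < `|B| + 1 by rewrite ltr_wpDl.
  have eB : 0 < e / (`|B| + 1) by rewrite divr_gt0.
  have [r r0 hr] := is_derive_approx dg eB.
  apply/nbhs_ballP; exists r => //= h; rewrite /ball/= sub0r normrN => hlt h0.
  rewrite sub0r normrN /GRing.scale/= mulr1 (addrC h) normrM normfV.
  rewrite ler_pdivrMl ?normr_gt0// (le_trans (fg _))//.
  have := hr _ hlt; rewrite mul0r subr0 => gh.
  rewrite (@le_trans _ _ ((`|B| + 1) * `|g (s + h) - g s|))//.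
    by rewrite ler_wpM2r// (le_trans (ler_norm _))// lerDl.
  rewrite (le_trans (ler_wpM2l (ltW B1) gh))//.
  by rewrite mulrA (mulrC _ (e / _)) divfK ?gt_eqF// mulrC.
by apply: DeriveDef; [apply/cvg_ex; exists 0|exact: cvg_lim H].
Qed.

(** Half of the weighted slice length, cut off to the open interval because the slices over a and b
    may be vertical sides of E. *)
Definition slice_density (R : realType) (E : set (R * R)) (a b : R)
    (f : R -> R) : R -> R :=
  (fun r => f r * half_slice E r) \_ `]a, b[.

Section slices.
Context {R : realType} (E : set (R * R)) (x y x1 y1 k : R -> R) (L : R).
Hypothesis H : convex_loop E x y x1 y1 k L.
Context (a b Z s0 m s1 m' : R).
Hypothesis Q : loop_quadrants E x y x1 y1 L a b Z s0 m s1 m'.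
Implicit Types (s t r z : R).

Let dx := cl_dx H.
Let dy := cl_dy H.
Let supp := @cl_support _ _ _ _ _ _ _ _ H.
Let mem := cl_mem H.
Let mu := @lebesgue_measure R.
Let zeta := half_slice E.

Lemma half_slice_spec r : a < r < b ->
  [/\ 0 <= zeta r <= Z, closure E (r, zeta r) &
    forall z, closure E (r, z) -> `|z| <= zeta r].
Proof.
move=> rab; have [h0 h1 h2 h3 h4] := lq_order Q.
have [xs0 ys0 _ _] := lq_s0 Q; have [xs1 ys1 _ _] := lq_s1 Q.
have [s ss xs] : exists2 s, s0 <= s <= s1 & x s - r = 0.
  apply: (@continuous_zero R (fun s => x s - r)); [|lra|by rewrite xs0 xs1; nra].
  by move=> t; apply: cvgB; [exact: is_derive_continuous (dx t)|exact: cvg_cst].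
have {}xs : x s = r by lra.
have ys := lq_axis Q ss.
have x1s : x1 s < 0.
  rewrite lt_neqAle (lq_vertical Q) ?xs//=.
  have [sm|ms] := leP s m.
    by have /(lq_I Q)/andP[] : s0 <= s <= m by lra.
  by have /(lq_II Q)/andP[] : m <= s <= s1 by lra.
have ub z : closure E (r, z) -> z <= y s.
  by move=> /(supp s) /=; rewrite xs subrr mulr0; nra.
have Ky : closure E (r, y s) by rewrite -xs; exact: (@mem s).
have zE : zeta r = y s.
  apply/eqP; rewrite eq_le; apply/andP; split.
    by apply: ge_sup; [exists (y s)|move=> z; exact: ub].
  by apply: ub_le_sup => //; exists (y s) => z; exact: ub.
rewrite zE; split => //.
  by rewrite ys; have /andP[_ /andP[_ /=]] := lq_range Q Ky.
move=> z Kz; rewrite ler_norml ub// andbT.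
by have := ub _ (cl_sym H Kz); lra.
Qed.

Lemma half_slice_curve s : a < x s < b -> `|y s| = zeta (x s).
Proof.
move=> xs; have [zZ Kz ub] := half_slice_spec xs.
apply/eqP; rewrite eq_le ub//=.
have := supp s Kz; have := supp s (cl_sym H Kz); rewrite /= subrr mulr0.
have := lq_vertical Q xs; rewrite neq_lt => /orP[x1s|x1s] u1 u2.
  have : zeta (x s) <= y s by nra.
  by move=> /le_trans; apply; exact: ler_norm.
have : zeta (x s) <= - y s by nra.
by move=> /le_trans; apply; rewrite -normrN; exact: ler_norm.
Qed.

(** Curve points have |z| equal to the slice height, so a point of the closure strictly below it is
    interior. This yields points of E itself and not only of its closure. *)
Lemma half_slice_interior r z : a < r < b -> `|z| < zeta r -> E (r, z).
Proof.
move=> rab zr; have [zZ Kz ub] := half_slice_spec rab.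
have z0 : 0 < zeta r by rewrite (le_lt_trans _ zr).
have Krz : closure E (r, z).
  have t01 : 0 <= (z / zeta r + 1) / 2 <= 1.
    have : `|z / zeta r| <= 1.
      by rewrite normrM normfV (gtr0_norm z0) ler_pdivrMr// mul1r ltW.
    by rewrite ler_norml; lra.
  have := cl_convex H Kz (cl_sym H Kz) t01.
  by congr (closure E (_, _)) => /=; field; rewrite gt_eqF.
have [[s [rs zs]]|] := cl_boundary H Krz; last exact: interior_subset.
by move: zr; rewrite zs half_slice_curve -?rs// ltxx.
Qed.

(** Two instances of concavity of the slice height, from the chords to (b, 0) and to (a, 0); they
    suffice for continuity. *)
Lemma half_slice_below r r' : a < r < b -> a < r' < b -> r <= r' ->
  zeta r * (b - r') <= zeta r' * (b - r) /\ zeta r' * (r - a) <= zeta r * (r' - a).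
Proof.
move=> rab rab' rr'.
have [_ Kr ub] := half_slice_spec rab; have [_ Kr' ub'] := half_slice_spec rab'.
have br : 0 < b - r by lra.
have ra : 0 < r' - a by lra.
split.
  have t01 : 0 <= (b - r') / (b - r) <= 1.
    by rewrite divr_ge0 ?ler_pdivrMr//; lra.
  have := cl_convex H Kr (lq_b Q) t01.
  rewrite (_ : (_, _) = (r', (b - r') / (b - r) * zeta r)).
    move=> /ub' /(le_trans (ler_norm _)).
    by rewrite mulrAC ler_pdivrMr// mulrC.
  by congr pair => /=; field; rewrite gt_eqF.
have t01 : 0 <= (r - a) / (r' - a) <= 1.
  by rewrite divr_ge0 ?ler_pdivrMr//; lra.
have := cl_convex H Kr' (lq_a Q) t01.
rewrite (_ : (_, _) = (r, (r - a) / (r' - a) * zeta r')).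
  move=> /ub /(le_trans (ler_norm _)).
  by rewrite mulrAC ler_pdivrMr// mulrC.
by congr pair => /=; field; rewrite gt_eqF.
Qed.

Lemma half_slice_continuous r : a < r < b -> {for r, continuous zeta}.
Proof.
move=> rab.
(* The two terms bound the slopes of the chords to (b, 0) and to (a, 0), as heights are at most
   Z. *)
pose M := Z / (b - r) + Z / (r - a).
have Z0 := lq_Z Q.
have br : 0 < b - r by lra.
have ra : 0 < r - a by lra.
have M0 : 0 < M by rewrite addr_gt0// divr_gt0.
have q1 d u : 0 <= u -> (b - r) * d <= Z * u -> d <= M * u.
  move=> u0 h; rewrite mulrDl (@le_trans _ _ (Z / (b - r) * u))//.
    by rewrite mulrAC ler_pdivlMr// mulrC.
  by rewrite lerDl mulr_ge0// divr_ge0// ltW.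
have q2 d u : 0 <= u -> (r - a) * d <= Z * u -> d <= M * u.
  move=> u0 h; rewrite mulrDl (@le_trans _ _ (Z / (r - a) * u))//.
    by rewrite mulrAC ler_pdivlMr// mulrC.
  by rewrite lerDr mulr_ge0// divr_ge0// ltW.
have lip r' : a < r' < b -> `|zeta r - zeta r'| <= M * `|r - r'|.
  move=> rab'.
  have [/andP[z0 zZ] _ _] := half_slice_spec rab.
  have [rr'|rr'] := leP r r'.
    have [h1 h2] := half_slice_below rab rab' rr'.
    rewrite (ler0_norm (_ : r - r' <= 0)); last by lra.
    rewrite opprB ler_norml lerNl opprB; apply/andP; split.
      by apply: q2; nra.
    by apply: q1; nra.
  have [h1 h2] := half_slice_below rab' rab (ltW rr').
  rewrite (gtr0_norm (_ : 0 < r - r')); last by lra.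
  rewrite ler_norml lerNl opprB; apply/andP; split.
    by apply: q1; nra.
  by apply: q2; nra.
apply/cvgrPdist_le => e e0; near=> r'.
have rab' : a < r' < b.
  by apply/andP; split; near: r'; [apply: lt_nbhsr|apply: lt_nbhsl]; lra.
apply: (le_trans (lip _ rab')); rewrite -ler_pdivlMl//.
near: r'; have /= := @cvgr_dist_le _ _ _ _ (nbhs_filter r) id r (@cvg_id _ _) (M^-1 * e).
by apply; rewrite mulr_gt0// invr_gt0.
Unshelve. all: by end_near. Qed.

Section density.
Variables (f : R -> R) (B : R).
Hypothesis fc : forall r, a < r < b -> {for r, continuous f}.
Hypothesis fB : forall r, a < r < b -> `|f r| <= B.

Let h := slice_density E a b f.

Lemma slice_densityE r : a < r < b -> h r = f r * zeta r.
Proof.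
by move=> rab; rewrite /h /slice_density patchE mem_set//= in_itv.
Qed.

Lemma slice_density_out r : ~~ (a < r < b) -> h r = 0.
Proof.
move=> rab; rewrite /h /slice_density patchE memNset//= in_itv/=.
exact/negP.
Qed.

Lemma measurable_slice_density : measurable_fun setT h.
Proof.
apply/(measurable_restrictT (fun r => f r * half_slice E r)) => //.
apply: open_continuous_measurable_fun; first exact: itv_open.
move=> r; rewrite inE/= in_itv/= => rab.
by apply: cvgM; [exact: fc|exact: half_slice_continuous].
Qed.

Lemma slice_density_bound r : `|h r| <= B * Z.
Proof.
have B0 : 0 <= B.
  have /andP[_ ab] := lq_ab Q.
  have /fB : a < (a + b) / 2 < b by lra.
  exact: le_trans.
have [rab|rab] := boolP (a < r < b); last first.
  by rewrite slice_density_out// normr0 mulr_ge0// ltW// (lq_Z Q).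
have [/andP[z0 zZ] _ _] := half_slice_spec rab.
by rewrite slice_densityE// normrM ler_pM// ?fB// ger0_norm.
Qed.

Lemma integrable_slice_density c d : mu.-integrable `[c, d] (EFin \o h).
Proof.
apply: measurable_bounded_integrable => //.
- exact: lebesgue_measure_segment_lty.
- exact: measurable_funTS measurable_slice_density.
- exists (B * Z); split; first exact: num_real.
  move=> M hM r _; apply: (le_trans (slice_density_bound r)); exact: ltW.
Qed.

Let G r := \int[mu]_(t in `[a, r]) h t.

Lemma is_derive_slice_integral r : a < r < b -> is_derive r (1 : R) G (h r).
Proof.
move=> rab; have /andP[ar rb] := rab.
have hc : {for r, continuous h}.
  have : {for r, continuous (fun r => f r * zeta r)}.
    by apply: cvgM; [exact: fc|exact: half_slice_continuous].
  rewrite /prop_for /continuous_at -(slice_densityE rab).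
  apply: cvg_trans; apply: near_eq_cvg; near=> r'.
  rewrite slice_densityE//.
  by apply/andP; split; near: r'; [apply: lt_nbhsr|apply: lt_nbhsl].
have [|dG Gh] := continuous_FTC1_closed rb _ ar hc.
  exact: integrable_slice_density.
apply: DeriveDef; first exact: dG.
by rewrite -derive1E; exact: Gh.
Unshelve. all: by end_near. Qed.

Lemma slice_integral_lip r r' : a <= r <= b -> a <= r' <= b ->
  `|G r' - G r| <= B * Z * `|r' - r|.
Proof.
have wlog_le u v : a <= u -> u <= v -> `|G v - G u| <= B * Z * (v - u).
  move=> au uv; rewrite /G (@Rintegral_itvB _ h (BLeft a) (BRight v) u) //=.
  - have iuv : mu.-integrable `]u, v] (EFin \o h).
      apply: integrableS (integrable_slice_density u v) => //.
      exact: subset_itv_oc_cc.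
    rewrite (le_trans (le_normr_Rintegral _ iuv))//.
    rewrite -(Rintegral_cst_itv _ false false uv); apply: le_Rintegral => //.
    - exact: integrable_norm.
    - apply: measurable_bounded_integrable => //.
        apply: le_lt_trans (lebesgue_measure_segment_lty u v).
        by apply: le_measure; rewrite ?inE//; exact: subset_itv_oc_cc.
      exists (`|B * Z|); split; first exact: num_real.
      by move=> M hM ? _; exact: ltW.
    - by move=> t _; exact: slice_density_bound.
  - exact: integrable_slice_density.
move=> /andP[ar rb] /andP[ar' rb'].
have [rr'|rr'] := leP r r'.
  by rewrite (ger0_norm (_ : 0 <= r' - r)) ?subr_ge0//; exact: wlog_le.
rewrite distrC (ltr0_norm (_ : r' - r < 0)) ?subr_lt0// opprB.
by apply: wlog_le => //; exact: ltW.
Qed.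

(* [half_slice E] may jump at a and b, where E can have vertical sides; but
   there x1 vanishes, and G is Lipschitz. *)
Lemma is_derive_slice_integral_curve s :
  is_derive s (1 : R) (fun t => G (x t)) (f (x s) * (`|y s| * x1 s)).
Proof.
have Kx t : a <= x t <= b by have /andP[] := lq_range Q (@mem t).
have [xab|xab] := boolP (a < x s < b).
  have dG := is_derive_slice_integral xab.
  have := @is_derive1_comp R G x s _ _ dG (dx s).
  by rewrite slice_densityE// half_slice_curve// mulrA.
have x10 : x1 s = 0.
  have [sa|sa] := eqVneq (x s) a.
    apply/eqP; rewrite -oppr_eq0; apply/eqP.
    apply: (@max_derive0 R (- x) (- x1)) => t.
      by have := dx t; exact: is_deriveN.
    by rewrite !fctE lerN2 sa; have /andP[] := Kx t.
  have sb : x s = b.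
    have /andP[ax xb] := Kx s; apply/eqP; move: xab.
    by rewrite !lt_neqAle eq_sym sa ax xb/= andbT negbK.
  by apply: (max_derive0 dx) => t; rewrite sb; have /andP[] := Kx t.
rewrite x10 !mulr0; apply: (@is_derive0_dominated _ _ x s (B * Z)).
  by have := dx s; rewrite x10.
by move=> t; apply: slice_integral_lip; exact: Kx.
Qed.

End density.

(* After integration by parts the integrand becomes y * x1 / x ^+ 2, which is the
   derivative of G \o x up to the sign of y. *)
Lemma green_inverse (F : R -> R) :
  (forall s, 0 <= s -> is_derive s (1 : R) F (y1 s / x s)) ->
  F (s0 + L) - F s0 =
  - (2 * \int[mu]_(r in `[a, b]) slice_density E a b (fun r => (r ^+ 2)^-1) r).
Proof.
move=> dF; have [h0 h1 h2 h3 h4] := lq_order Q.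
have [xs0 ys0 _ _] := lq_s0 Q; have [xs1 ys1 _ _] := lq_s1 Q.
have /andP[a0 ab] := lq_ab Q.
pose f := fun r : R => (r ^+ 2)^-1.
have fc r : a < r < b -> {for r, continuous f}.
  move=> /andP[ar _]; have r0 : r != 0 by rewrite gt_eqF// (lt_trans a0).
  by apply: cvgV; [rewrite sqrf_eq0|exact: exprn_continuous].
have fB r : a < r < b -> `|f r| <= (a ^+ 2)^-1.
  move=> /andP[ar _]; have r0 : 0 < r by rewrite (lt_trans a0).
  rewrite /f ger0_norm ?invr_ge0 ?sqr_ge0// lef_pV2 ?posrE ?exprn_gt0//.
  by rewrite lerXn2r ?nnegrE ?ltW.
have dG := is_derive_slice_integral_curve fc fB.
pose G r := \int[mu]_(t in `[a, r]) slice_density E a b f t.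
have x0 s : 0 < x s by have := cl_half H (@mem s).
have dyx s : is_derive s (1 : R) (fun t => y t / x t)
    (y1 s / x s - y s * x1 s / x s ^+ 2).
  have xn0 : x s != 0 by rewrite gt_eqF.
  have dV := @is_deriveV R x s (x1 s) 1 xn0 (dx s).
  have dM := @is_deriveM R R y (fun t => (x t)^-1) s 1 _ _ (dy s) dV.
  by apply: (is_derive_eq dM); rewrite /GRing.scale/=; field.
have dFy s : 0 <= s ->
    is_derive s (1 : R) (fun t => F t - y t / x t) (y s * x1 s / x s ^+ 2).
  move=> ss; have dB := @is_deriveB R R R F (fun t => y t / x t) s 1 _ _ (dF _ ss) (dyx s).
  by apply: (is_derive_eq dB); ring.
have ss1 : s0 <= s1 by lra.
have s1s : s1 <= s0 + L by lra.
have e1 : (F s1 - y s1 / x s1) - (F s0 - y s0 / x s0) = G (x s1) - G (x s0).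
  apply: (@derive_eq R (fun t => F t - y t / x t) (fun s => y s * x1 s / x s ^+ 2)
    (fun t => G (x t)) _ s0 s1 ss1 _ (fun s _ => dG s)) => s hs.
    by apply: dFy; lra.
  by rewrite (ger0_norm (lq_axis Q hs)) /f mulrC.
have e2 : (F (s0 + L) - y (s0 + L) / x (s0 + L)) - (F s1 - y s1 / x s1) =
    - G (x (s0 + L)) - - G (x s1).
  have dNG s := @is_deriveN R R R (fun t => G (x t)) s 1 _ (dG s).
  apply: (@derive_eq R (fun t => F t - y t / x t) (fun s => y s * x1 s / x s ^+ 2)
    (fun t => - G (x t)) _ s1 (s0 + L) s1s _ (fun s _ => dNG s)) => s hs.
    by apply: dFy; lra.
  by rewrite (ler0_norm (lq_axis' Q hs)) /f mulrC mulNr mulrN opprK.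
have Ga : G a = 0 by rewrite /G set_itv1 Rintegral_set1.
move: e1 e2; rewrite (cl_xL H) (cl_yL H) xs0 xs1 ys0 ys1 !mul0r !subr0 Ga /G.
lra.
Qed.

End slices.


(** * Plane integrals as integrals over slices *)

Lemma le_integral_restrict d (T : measurableType d) (R : realType)
    (mu : {measure set T -> \bar R}) (D D' : set T) (f g : T -> \bar R) :
  (forall t, D t -> 0 <= f t)%E -> (forall t, D' t -> 0 <= g t)%E ->
  (forall t, (f \_ D) t <= (g \_ D') t)%E ->
  (\int[mu]_(t in D) f t <= \int[mu]_(t in D') g t)%E.
Proof.
move=> f0 g0 fg; rewrite !ge0_integralE//; apply: ereal_sup_le.
by move=> _ [h hf <-]; exists h => // t; exact: le_trans (hf t) (fg t).
Qed.

Section product.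
Context {R : realType}.
Let mu := @lebesgue_measure R.

Lemma integral_sections (A : set (measurableTypeR R * measurableTypeR R))
    (f g : R -> R) : measurable A -> measurable_fun setT f ->
  (forall r, 0 <= f r) -> (forall r, mu (xsection A r) = (g r)%:E) ->
  (\int[mu \x mu]_(p in A) (f p.1)%:E = \int[mu]_r (f r * g r)%:E)%E.
Proof.
move=> mA mf f0 Ag.
rewrite integral_mkcond fubini_tonelli1; last 2 first.
- apply/(measurable_restrictT _ mA); apply: measurable_funTS.
  apply/measurable_EFinP.
  exact: (measurableT_comp mf measurable_fst).
- by move=> p; rewrite patchE; case: ifP => //; rewrite lee_fin.
apply: eq_integral => r _; rewrite /fubini_F.
transitivity (\int[mu]_(z in xsection A r) (f r)%:E)%E.
  rewrite [RHS]integral_mkcond; apply: eq_integral => z _.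
  by rewrite !patchE mem_xsection.
rewrite integral_cst; last exact: measurable_xsection.
by rewrite EFinM; congr (_ * _)%E; exact: Ag.
Qed.

End product.

(* E may contain a non-measurable part of its boundary, so that it need not be
   measurable in the plane; it is squeezed between the measurable sets [inner]
   and [outer].  No measurability is needed to compare integrals of nonnegative
   functions, which are suprema over simple functions. *)
Section plane_integrals.
Context {R : realType} (E : set (R * R)) (x y x1 y1 k : R -> R) (L : R).
Hypothesis H : convex_loop E x y x1 y1 k L.
Context (a b Z s0 m s1 m' : R).
Hypothesis Q : loop_quadrants E x y x1 y1 L a b Z s0 m s1 m'.
Implicit Types (r z : R).

Let mu := @lebesgue_measure R.
Let h := slice_density E a b (fun=> 1).
(** Over a and b the height is raised to Z to cover possible vertical sides; this affects two lines
    of measure zero. *)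
Let ho r := h r + Z * \1_(~` `]a, b[) r.
Let inner : set (measurableTypeR R * measurableTypeR R) :=
  [set p | `|p.2| < h p.1].
Let outer : set (measurableTypeR R * measurableTypeR R) :=
  [set p | (a <= p.1 <= b) && (`|p.2| <= ho p.1)].

Let mh : measurable_fun setT h.
Proof. by apply: (measurable_slice_density H Q) => r _; exact: cvg_cst. Qed.

Let mho : measurable_fun setT ho.
Proof.
apply: measurable_funD => //; apply: measurable_funM => //.
apply: measurable_indic; exact: measurableC.
Qed.

Let h_in r : a < r < b -> h r = half_slice E r.
Proof. by move=> rab; rewrite /h slice_densityE// mul1r. Qed.

Let h_out r : ~~ (a < r < b) -> h r = 0.
Proof. exact: slice_density_out. Qed.

Let h_ge0 r : 0 <= h r.
Proof.
have [rab|rab] := boolP (a < r < b); last by rewrite h_out.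
by rewrite h_in//; have [/andP[]] := half_slice_spec H Q rab.
Qed.

Let ho_in r : a < r < b -> ho r = h r.
Proof.
by move=> rab; rewrite /ho indicE memNset ?mulr0 ?addr0//= in_itv/= rab.
Qed.

Let ho_out r : ~~ (a < r < b) -> ho r = Z.
Proof.
move=> rab; rewrite /ho indicE mem_set ?mulr1 ?h_out ?add0r//.
by move=> /=; rewrite in_itv/=; exact/negP.
Qed.

Let inner_sub : inner `<=` E.
Proof.
move=> [r z]; rewrite /inner/=; have [rab|rab] := boolP (a < r < b).
  by rewrite h_in//; exact: (half_slice_interior H Q rab).
by rewrite h_out// normr_lt0.
Qed.

Let sub_outer : E `<=` outer.
Proof.
move=> [r z] /subset_closure Krz; rewrite /outer/=.
have /andP[/= -> /=] := lq_range Q Krz.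
have [rab|rab] := boolP (a < r < b); last by rewrite ho_out// ler_norml.
by move=> _; rewrite ho_in// h_in//; have [_ _] := half_slice_spec H Q rab; apply.
Qed.

Let m_inner : measurable inner.
Proof.
rewrite (_ : inner = (fun p => h p.1 - `|p.2|) @^-1` `]0, +oo[); last first.
  by apply/seteqP; split=> p /=; rewrite in_itv/= andbT subr_gt0.
rewrite -[X in measurable X]setTI; apply: measurable_funB => //.
- exact: (measurableT_comp mh measurable_fst).
- exact: (measurableT_comp (@normr_measurable R setT) measurable_snd).
Qed.

Let m_outer : measurable outer.
Proof.
rewrite (_ : outer = (fst @^-1` `[a, b]) `&`
    ((fun p => ho p.1 - `|p.2|) @^-1` `[0, +oo[)); last first.
  apply/seteqP; split=> p /=; rewrite !in_itv/= andbT subr_ge0; first by case/andP.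
  by move=> [pab pz]; apply/andP.
apply: measurableI; rewrite -[X in measurable X]setTI.
  exact: measurable_fst.
apply: measurable_funB => //.
- exact: (measurableT_comp mho measurable_fst).
- exact: (measurableT_comp (@normr_measurable R setT) measurable_snd).
Qed.

Let sec_inner r : mu (xsection inner r) = (2 * h r)%:E.
Proof.
have -> : xsection inner r = `]- h r, h r[%classic.
  by apply/seteqP; split=> z; rewrite /xsection/= inE /inner/= in_itv/= ltr_norml.
rewrite /mu lebesgue_measure_itv/= lte_fin.
case: ifPn => [_|]; first by rewrite -EFinB; congr EFin; ring.
by rewrite -leNgt => h2; congr EFin; have := h_ge0 r; lra.
Qed.

Let sec_outer r : mu (xsection outer r) = (if a <= r <= b then 2 * ho r else 0)%:E.
Proof.
have ho0 : 0 <= ho r.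
  have [rab|rab] := boolP (a < r < b); first by rewrite ho_in.
  by rewrite ho_out// ltW// (lq_Z Q).
case: ifPn => rab.
  have -> : xsection outer r = `[- ho r, ho r]%classic.
    apply/seteqP; split=> z; rewrite /xsection/= inE /outer/= in_itv/= -ler_norml;
      by rewrite rab.
  rewrite /mu lebesgue_measure_itv/= lte_fin.
  case: ifPn => [_|]; first by rewrite -EFinB; congr EFin; ring.
  by rewrite -leNgt => h2; congr EFin; lra.
have -> : xsection outer r = set0; last exact: measure0.
by apply/seteqP; split=> z//; rewrite /xsection/= inE /outer/= (negbTE rab).
Qed.

Section integrand.
Variable f : R -> R.
Hypothesis fc : forall r, a <= r <= b -> {for r, continuous f}.
Hypothesis f0 : forall r, a <= r <= b -> 0 <= f r.

Let fab := f \_ `[a, b].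

Let mfab : measurable_fun setT fab.
Proof.
apply/(measurable_restrictT f) => //.
apply: subspace_continuous_measurable_fun => //.
by apply: continuous_in_subspaceT => r; rewrite inE/= in_itv/= => /fc.
Qed.

Let fab0 r : 0 <= fab r.
Proof.
by rewrite /fab patchE; case: ifPn => //; rewrite inE/= in_itv/= => /f0.
Qed.

Let I := (\int[mu]_(r in `[a, b]) (2 * slice_density E a b f r)%:E)%E.

Let support_integral (g : R -> R) : measurable_fun setT g ->
  (forall r, a < r < b -> g r = 2 * h r) ->
  (\int[mu]_r (fab r * g r)%:E = I)%E.
Proof.
move=> mg gh.
have mF : measurable_fun setT (fun r => (fab r * g r)%:E).
  exact/measurable_EFinP/measurable_funM.
have mG : measurable_fun setT (fun r => (2 * slice_density E a b f r)%:E).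
  apply/measurable_EFinP/measurable_funM => //.
  apply: (@measurable_slice_density _ _ _ _ _ _ _ _ H _ _ _ _ _ _ _ Q) => r rab.
  by apply: fc; lra.
transitivity (\int[mu]_(r in `[a, b]) (fab r * g r)%:E)%E.
  rewrite [RHS]integral_mkcond; apply: eq_integral => r _.
  rewrite patchE; case: ifPn => // rab.
  by rewrite /fab patchE (negbTE rab) mul0r.
rewrite /I -!integral_itv_obnd_cbnd; [|exact: measurable_funTS..].
rewrite -!integral_itv_bndo_bndc; [|exact: measurable_funTS..].
apply: eq_integral => r; rewrite inE/= in_itv/= => rab.
rewrite gh// h_in// slice_densityE// /fab patchE mem_set.
  by congr EFin; ring.
by rewrite /= in_itv/=; lra.
Qed.

Lemma inner_integral : (\int[mu \x mu]_(p in inner) (fab p.1)%:E = I)%E.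
Proof.
rewrite (integral_sections m_inner mfab fab0 sec_inner).
by apply: support_integral => //; exact: measurable_funM.
Qed.

Lemma outer_integral : (\int[mu \x mu]_(p in outer) (fab p.1)%:E = I)%E.
Proof.
rewrite (integral_sections m_outer mfab fab0 sec_outer).
apply: support_integral => [|r rab].
  rewrite (_ : (fun r => _) = (fun r => 2 * ho r) \_ `[a, b]); last first.
    apply/funext => r; rewrite patchE; case: ifPn => rab.
      by rewrite mem_set//= in_itv.
    by rewrite memNset//= in_itv/=; exact/negP.
  apply/(measurable_restrictT (fun r => 2 * ho r)) => //.
  by apply: measurable_funTS; exact: measurable_funM.
by rewrite ho_in// ifT//; lra.
Qed.

Lemma integral_slices :
  (\int[(@lebesgue_measure R \x @lebesgue_measure R)%E]_(p in E) (f p.1)%:E = I)%E.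
Proof.
transitivity (\int[mu \x mu]_(p in E) (fab p.1)%:E)%E.
  apply: eq_integral => p; rewrite inE => /subset_closure Kp.
  rewrite /fab patchE mem_set//= in_itv/=.
  by have /andP[] := lq_range Q Kp.
have fabp p : (0 <= (fab p)%:E)%E by rewrite lee_fin.
apply/eqP; rewrite eq_le; apply/andP; split.
  rewrite -outer_integral; apply: le_integral_restrict => // p.
  rewrite !patchE; case: ifPn => pE; case: ifPn => pO //.
  by case/negP: pO; rewrite inE; apply: sub_outer; rewrite -inE.
rewrite -inner_integral; apply: le_integral_restrict => // p.
rewrite !patchE; case: ifPn => pI; case: ifPn => pE //.
by case/negP: pE; rewrite inE; apply: inner_sub; rewrite -inE.
Qed.

Lemma plane_integral_slices : plane_integral E (fun p => f p.1) =
  2 * \int[mu]_(r in `[a, b]) slice_density E a b f r.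
Proof.
rewrite /plane_integral /Rintegral integral_slices /I.
have [B fB] : exists B, forall r, a < r < b -> `|f r| <= B.
  have ab : a <= b by case/andP: (lq_ab Q) => _ /ltW.
  have [|c cab cmax] := @EVT_max R (fun r => `|f r|) a b ab.
    apply: continuous_in_subspaceT => r; rewrite inE/= in_itv/= => /fc fr.
    exact: (continuous_comp fr (@norm_continuous _ _ (f r))).
  exists `|f c| => r rab; apply: cmax; rewrite in_itv/=; lra.
have fc' r : a < r < b -> {for r, continuous f} by move=> rab; apply: fc; lra.
have := @RintegralZl _ _ _ mu `[a, b] (slice_density E a b f) 2.
apply => //.
exact: (integrable_slice_density H Q fc' fB).
Qed.

End integrand.

(** The product measure of any set unfolds to the integral of the lengths of its vertical sections.
    Those of E are intervals by convexity, hence measurable, so the comparison with [inner] and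
    [outer] can be made section by section. *)
Lemma area_slices : plane_convex E ->
  area E = 2 * \int[mu]_(r in `[a, b]) slice_density E a b (fun=> 1) r.
Proof.
move=> cE; have one r : a <= r <= b -> {for r, continuous (fun=> 1 : R)}.
  by move=> _; exact: cvg_cst.
have one0 r : a <= r <= b -> 0 <= 1 :> R by [].
rewrite -(plane_integral_slices one one0) /plane_integral /Rintegral /area.
congr fine.
have mE r : measurable (xsection E r).
  apply: is_interval_measurable => z z'; rewrite /xsection/= !inE => Ez Ez' t.
  move=> /andP[zt tz']; rewrite inE.
  have [zz|zz] := leP z' z; first by rewrite (_ : t = z)//; lra.
  have t01 : 0 <= (z' - t) / (z' - z) <= 1.
    by rewrite divr_ge0 ?ler_pdivrMr//; lra.
  have := cE _ _ _ Ez Ez' t01.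
  by congr (E (_, _)) => /=; field; lra.
rewrite (integral_slices one one0).
have pm (A : set (measurableTypeR R * measurableTypeR R)) : measurable A ->
    (forall p, A p -> a <= p.1 <= b) ->
    (\int[mu \x mu]_(p in A) (((fun=> 1 : R) : R -> R) \_ `[a, b] p.1)%:E = (mu \x mu) A)%E.
  move=> mA Aab; rewrite -[RHS]mul1e -integral_cst//; apply: eq_integral => p.
  by rewrite inE => /Aab pab; rewrite patchE mem_set//= in_itv.
have le_section A B r : (A `<=` B) -> measurable (xsection A r) ->
    measurable (xsection B r) -> (mu (xsection A r) <= mu (xsection B r))%E.
  move=> AB mA mB; apply: le_measure; rewrite ?inE// => z.
  by rewrite /xsection/= !inE; exact: AB.
apply/eqP; rewrite eq_le; apply/andP; split.
  rewrite -(outer_integral one one0) pm//; last by move=> p /andP[].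
  rewrite /product_measure1; apply: le_integral_restrict => // r.
  rewrite !patch_setT.
  exact: (le_section E outer r sub_outer (mE r) (measurable_xsection r m_outer)).
rewrite -(inner_integral one one0) pm//; last first.
  by move=> p /inner_sub/sub_outer/andP[].
rewrite /product_measure1; apply: le_integral_restrict => // r.
rewrite !patch_setT.
exact: (le_section inner E r inner_sub (measurable_xsection r m_inner) (mE r)).
Qed.

End plane_integrals.


(** * Bounds on the area and on the moments of the section *)

Section estimates.
Context {R : realType} (E : set (R * R)) (x y x1 y1 k : R -> R) (L : R).
Hypothesis H : convex_loop E x y x1 y1 k L.
Context (a b Z s0 m s1 m' : R).
Hypothesis Q : loop_quadrants E x y x1 y1 L a b Z s0 m s1 m'.
Implicit Types (f g : R -> R) (r z : R).

Let mu := @lebesgue_measure R.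
Let a0 : 0 < a. Proof. by case/andP: (lq_ab Q). Qed.
Let ab : a < b. Proof. by case/andP: (lq_ab Q). Qed.
Let Z0 : 0 < Z. Proof. exact: lq_Z Q. Qed.
Let D f := slice_density E a b f.
Let I f := \int[mu]_(r in `[a, b]) D f r.
Let admissible f := (forall r, a < r < b -> {for r, continuous f}) /\
  exists B : R, forall r, a < r < b -> `|f r| <= B.

Let DE f r : D f r = f r * D (fun=> 1) r.
Proof.
have [rab|rab] := boolP (a < r < b).
  by rewrite /D !slice_densityE// mul1r.
by rewrite /D !slice_density_out// mulr0.
Qed.

Let iD f : admissible f -> mu.-integrable `[a, b] (EFin \o D f).
Proof. by move=> [fc [B fB]]; exact: (integrable_slice_density H Q fc fB). Qed.

Let D_ge0 r : 0 <= D (fun=> 1) r.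
Proof.
have [rab|rab] := boolP (a < r < b); last by rewrite /D slice_density_out.
by rewrite /D slice_densityE// mul1r; have [/andP[]] := half_slice_spec H Q rab.
Qed.

Let le_I f g : admissible f -> admissible g ->
  (forall r, a < r < b -> f r <= g r) -> I f <= I g.
Proof.
move=> fa ga fg; apply: le_Rintegral => //; [exact: iD|exact: iD|].
move=> r _; have [rab|rab] := boolP (a < r < b).
  by rewrite DE (DE g) ler_wpM2r// fg.
by rewrite /D !slice_density_out.
Qed.

Let adm_cst v : admissible (fun=> v).
Proof. by split=> [r _|]; [exact: cvg_cst|exists `|v|]. Qed.

Let adm_id : admissible (fun r => r).
Proof.
split=> [r _|]; first exact: cvg_id.
by exists b => r rab; move: a0 => ?; rewrite ger0_norm; lra.
Qed.

Let adm_invsq : admissible (fun r => (r ^+ 2)^-1).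
Proof.
split=> [r /andP[ar _]|].
  have r0 : r != 0 by rewrite gt_eqF// (lt_trans a0).
  by apply: cvgV; [rewrite sqrf_eq0|exact: exprn_continuous].
exists (a ^+ 2)^-1 => r /andP[ar _]; have r0 : 0 < r by rewrite (lt_trans a0).
rewrite ger0_norm ?invr_ge0 ?sqr_ge0// lef_pV2 ?posrE ?exprn_gt0//.
by rewrite lerXn2r ?nnegrE ?ltW.
Qed.

Let adm_line u v : admissible (fun r => u + v * r).
Proof.
split=> [r _|].
  by apply: cvgD; [exact: cvg_cst|apply: cvgM; [exact: cvg_cst|exact: cvg_id]].
exists (`|u| + `|v| * b) => r rab.
have r0 : 0 <= r by move: a0 => ?; lra.
by rewrite (le_trans (ler_normD _ _))// lerD2l normrM (ger0_norm r0) ler_wpM2l//; lra.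
Qed.

Let I_line u v : I (fun r => u + v * r) = u * I (fun=> 1) + v * I (fun r => r).
Proof.
rewrite /I -!RintegralZl//; [|exact: iD..].
rewrite -RintegralD//.
- by apply: eq_Rintegral => r _; rewrite DE (DE (fun r => r)); ring.
- exact: (integrableZl _ u (iD (adm_cst 1))).
- exact: (integrableZl _ v (iD adm_id)).
Qed.

Lemma slices_le : I (fun=> 1) <= Z * (b - a).
Proof.
have -> : Z * (b - a) = \int[mu]_(r in `[a, b]) Z.
  by rewrite (Rintegral_cst_itv _ true false (ltW ab)).
apply: le_Rintegral => //; first exact: iD.
  apply: measurable_bounded_integrable => //.
    exact: lebesgue_measure_segment_lty.
  exists `|Z|; split; first exact: num_real.
  by move=> M hM ? _; exact: ltW.
move=> r _; have [rab|rab] := boolP (a < r < b).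
  rewrite /D slice_densityE// mul1r.
  by have [/andP[_ ?]] := half_slice_spec H Q rab.
by rewrite /D slice_density_out// ltW.
Qed.

(* E contains the triangle with base [a, b] * {0} and apex at height Z, whose
   slices have height at least Z / 2 on an interval of length (b - a) / 2. *)
Lemma slices_ge f (v : R) : admissible f -> 0 <= v ->
  (forall r, a < r < b -> (b - a) / 4 <= r -> v <= f r) ->
  (forall r, a < r < b -> 0 <= f r) ->
  v * (Z / 2) * ((b - a) / 4) <= I f.
Proof.
move=> fa v0 vf f0.
(* Midpoints of the apex with the right half of the base [a, b]. Giving up half of the available
   length ensures r >= (b - a) / 4 on ]c, d[, whatever the abscissa of the apex. *)
pose c := x m / 2 + (a + b) / 4; pose d := (x m + b) / 2.
have [h0 h1 h2 h3 h4] := lq_order Q.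
have [ym _ _] := lq_m Q.
have /andP[/= /andP[axm xmb] _] := lq_range Q (@cl_mem _ _ _ _ _ _ _ _ H m).
have cd : d - c = (b - a) / 4 by rewrite /c /d; field.
have ac : a <= c by rewrite /c; lra.
have db : d <= b by rewrite /d; lra.
have cd_ab (r : R) : c < r < d -> (a < r < b) && ((b - a) / 4 <= r).
  move=> /andP[cr rd]; have a0' := a0; move: cr rd; rewrite /c /d => cr rd.
  apply/andP; split; first by apply/andP; split; lra.
  lra.
have high r : c < r < d -> Z / 2 <= D (fun=> 1) r.
  move=> rcd; have rab : a < r < b by lra.
  rewrite /D slice_densityE// mul1r; have [_ _ ub] := half_slice_spec H Q rab.
  have t01 : 0 <= (2 * r - x m - a) / (b - a) <= 1.
    have : c < r < d by []; rewrite /c /d => hr.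
    by rewrite divr_ge0 ?ler_pdivrMr; lra.
  have Kr := cl_convex H (lq_b Q) (lq_a Q) t01.
  have h2' : 0 <= (2^-1 : R) <= 1 by lra.
  have := cl_convex H (@cl_mem _ _ _ _ _ _ _ _ H m) Kr h2'.
  rewrite (_ : (_, _) = (r, Z / 2)).
    by move=> /ub; rewrite ger0_norm// divr_ge0// ltW.
  by rewrite /= ym; congr pair; field; rewrite subr_eq0 gt_eqF.
have le_cd (r : R) : r \in `]c, d[ -> v * (Z / 2) <= D f r.
  rewrite in_itv/= => rcd; have /andP[rab ra] := cd_ab _ rcd.
  by rewrite DE ler_pM//; [rewrite divr_ge0// ltW|exact: vf|exact: high].
have -> : v * (Z / 2) * ((b - a) / 4) = \int[mu]_(r in `]c, d[) (v * (Z / 2)).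
  by rewrite Rintegral_cst_itv ?cd// -subr_ge0 cd; lra.
have sub_cd : `]c, d[ `<=` `[a, b].
  move=> r /=; rewrite !in_itv/=; lra.
have icd : mu.-integrable `]c, d[ (EFin \o D f).
  exact: integrableS (iD fa).
apply: (@le_trans _ _ (\int[mu]_(r in `]c, d[) D f r)).
  apply: le_Rintegral => //.
    apply: measurable_bounded_integrable => //.
      apply: le_lt_trans (lebesgue_measure_segment_lty a b).
      by apply: le_measure; rewrite ?inE//; exact: sub_cd.
    exists `|v * (Z / 2)|; split; first exact: num_real.
    by move=> M hM ? _; exact: ltW.
have Df0 r : 0 <= D f r.
  have [rab|rab] := boolP (a < r < b); last by rewrite /D slice_density_out.
  by rewrite DE mulr_ge0// f0.
rewrite /I /Rintegral fine_le//.
- exact: integrable_fin_num.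
- exact: (integrable_fin_num _ (iD fa)).
- apply: ge0_subset_integral => //.
  + by have /integrableP[] := iD fa.
  + by move=> r _; rewrite lee_fin.
Qed.

Lemma slices_jensen : 0 < I (fun=> 1) -> 0 < I (fun r => r) ->
  I (fun=> 1) ^+ 3 <= I (fun r => (r ^+ 2)^-1) * I (fun r => r) ^+ 2.
Proof.
set A := I _; set M := I _; set J := I _ => A0 M0.
(* 3 c^2 - 2 c^3 r is the tangent line of r^-2 at r = 1 / c. *)
pose c := A / M.
have c0 : 0 < c by rewrite divr_gt0.
have : I (fun r => 3 * c ^+ 2 + - (2 * c ^+ 3) * r) <= J.
  apply: le_I => // r /andP[ar _]; have r0 : 0 < r by rewrite (lt_trans a0).
  rewrite -subr_ge0 (_ : _ - _ = (c * r - 1) ^+ 2 * (2 * c * r + 1) / r ^+ 2).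
    have cr : 0 < c * r by rewrite mulr_gt0.
    apply: divr_ge0; last exact: sqr_ge0.
    by apply: mulr_ge0; [exact: sqr_ge0|lra].
  by field; rewrite gt_eqF.
have M2 : 0 < M ^+ 2 by rewrite exprn_gt0.
rewrite I_line -/A -/M -(ler_pM2r M2).
by congr (_ <= _); rewrite /c; field; rewrite gt_eqF.
Qed.

Lemma section_moments : plane_convex E ->
  [/\ 0 < area E, area E <= 2 * Z * (b - a),
    Z * (b - a) ^+ 2 / 16 <= plane_integral E (fun p => p.1) &
    area E ^+ 3 <= plane_integral E (fun p => (p.1 ^+ 2)^-1) *
                   plane_integral E (fun p => p.1) ^+ 2].
Proof.
move=> cE; have ab' := ab; have Z0' := Z0; have a0' := a0.
have w0 : 0 < b - a by lra.
have ids r : a <= r <= b -> {for r, continuous (fun r : R => r)}.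
  by move=> _; exact: cvg_id.
have id0 r : a <= r <= b -> 0 <= r by lra.
have invc r : a <= r <= b -> {for r, continuous (fun r : R => (r ^+ 2)^-1)}.
  move=> /andP[ar _]; have r0 : r != 0 by rewrite gt_eqF// (lt_le_trans a0).
  by apply: cvgV; [rewrite sqrf_eq0|exact: exprn_continuous].
have inv0 r : a <= r <= b -> 0 <= (r ^+ 2)^-1 by rewrite invr_ge0 sqr_ge0.
rewrite (area_slices H Q cE) (plane_integral_slices H Q ids id0).
rewrite (plane_integral_slices H Q invc inv0) -/(I _) -/(I _) -/(I _).
have hA : 1 * (Z / 2) * ((b - a) / 4) <= I (fun=> 1) by apply: slices_ge.
have hM : (b - a) / 4 * (Z / 2) * ((b - a) / 4) <= I (fun r => r).
  by apply: slices_ge => //; [lra|move=> r; lra].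
have A0 : 0 < I (fun=> 1).
  by apply: lt_le_trans hA; rewrite !mulr_gt0//; lra.
have M0 : 0 < I (fun r => r).
  by apply: lt_le_trans hM; rewrite !mulr_gt0//; lra.
split.
- by rewrite mulr_gt0.
- by rewrite -mulrA ler_pM2l// slices_le.
- by move: hM; set M := I _; lra.
- have := slices_jensen A0 M0; set A := I _; set J := I _; set M := I _ => h.
  have -> : 2 * J * (2 * M) ^+ 2 = 2 ^+ 3 * (J * M ^+ 2) by ring.
  by rewrite exprMn ler_pM2l.
Qed.

End estimates.


(** * Derivatives along lines and the one-sided normal derivative *)

Section directional.
Context {R : realType}.
Implicit Types (f : R * R -> R) (p v : R * R) (t : R).

Lemma is_derive_line f p v t : derivable f (p + t *: v) v ->
  is_derive t (1 : R) (fun t => f (p + t *: v)) ('D_v f (p + t *: v)).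
Proof.
move=> df.
have E : (fun h => h^-1 *: (f (p + (h *: (1 : R) + t) *: v) - f (p + t *: v))) =
    (fun h => h^-1 *: (f (h *: v + (p + t *: v)) - f (p + t *: v))).
  apply/funext => h; congr (_ *: (f _ - _)).
  have -> : h *: (1 : R) = h by rewrite /GRing.scale/= mulr1.
  by rewrite scalerDl addrCA.
have H : h^-1 *: (f (p + (h *: (1 : R) + t) *: v) - f (p + t *: v))
    @[h --> (0 : R)^'] --> 'D_v f (p + t *: v).
  by rewrite E; exact: df.
by apply: DeriveDef; [apply/cvg_ex; eexists; exact: H|exact: cvg_lim H].
Qed.

Lemma continuous_eps f p e : {for p, continuous f} -> 0 < e ->
  exists2 d, 0 < d & forall q, `|p.1 - q.1| < d -> `|p.2 - q.2| < d ->
    `|f q - f p| <= e.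
Proof.
move=> cf e0; have /cvgrPdist_le/(_ e e0)/nbhs_ballP[d /= d0 hd] := cf.
by exists d => // q q1 q2; rewrite distrC; apply: hd; split.
Qed.

Lemma open_eps (U : set (R * R)) p : open U -> U p ->
  exists2 d, 0 < d & forall q, `|p.1 - q.1| < d -> `|p.2 - q.2| < d -> U q.
Proof.
move=> oU Up; have /nbhs_ballP[d /= d0 hd] := open_nbhs_nbhs (conj oU Up).
by exists d => // q q1 q2; apply: hd; split.
Qed.

(** The increment is split at a corner [q]: along e_z derivability at p suffices, along e_r the mean
    value theorem and continuity of that partial derivative apply. *)
Lemma C1_is_derive (U : set (R * R)) f p v : open U -> C1_on U f -> U p ->
  is_derive p v f ('D_(e_r R) f p * v.1 + 'D_(e_z R) f p * v.2).
Proof.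
move=> oU C1 Up.
set l := (X in is_derive _ _ _ X).
suff H : h^-1 *: (f (h *: v + p) - f p) @[h --> (0 : R)^'] --> l.
  by apply: DeriveDef; [apply/cvg_ex; eexists; exact: H|exact: cvg_lim H].
have [_ dz _ cr _] := C1 _ Up.
apply/cvgrPdist_le => e e0.
pose B := `|v.1| + `|v.2| + 1.
have B0 : 0 < B by rewrite /B ltr_wpDl// addr_ge0.
have eB : 0 < e / (2 * B) by rewrite divr_gt0// mulr_gt0.
have [d1 d10 hd1] := open_eps oU Up.
have [d2 d20 hd2] := continuous_eps cr eB.
have dz0 : is_derive (0 : R) (1 : R) (fun t => f (p + t *: e_z R)) ('D_(e_z R) f p).
  have p0 : p + (0 : R) *: e_z R = p by rewrite scale0r addr0.
  by have := @is_derive_line f p (e_z R) 0; rewrite p0 => /(_ dz).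
have [d3 d30 hd3] := is_derive_approx dz0 eB.
pose d := Num.min d1 (Num.min d2 d3).
have d0 : 0 < d by rewrite !lt_min d10 d20.
apply/nbhs_ballP; exists (d / B) => /=; first by rewrite divr_gt0.
move=> h; rewrite /ball/= sub0r normrN ltr_pdivlMr// => hd h0.
have v1B : `|v.1| <= B by rewrite /B -addrA lerDl addr_ge0.
have v2B : `|v.2| <= B by rewrite /B addrAC lerDr addr_ge0.
have hv1 : `|h * v.1| < d.
  by rewrite normrM (le_lt_trans _ hd)// ler_wpM2l.
have hv2 : `|h * v.2| < d.
  by rewrite normrM (le_lt_trans _ hd)// ler_wpM2l.
move: (hv1) (hv2); rewrite /d !lt_min => /and3P[hv11 hv12 hv13] /and3P[hv21 hv22 hv23].
pose q := (p.1, p.2 + h * v.2).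
pose g t := f (q + t *: e_r R).
have qt t : q + t *: e_r R = (p.1 + t, p.2 + h * v.2).
  by rewrite /q /e_r; congr pair; rewrite /= /GRing.scale/= ?mulr1 ?mulr0 ?addr0.
have near_p t : `|t| <= `|h * v.1| ->
    U (q + t *: e_r R) /\ `|'D_(e_r R) f (q + t *: e_r R) - 'D_(e_r R) f p| <= e / (2 * B).
  move=> ht; rewrite qt; split.
    by apply: hd1 => /=; rewrite opprD addNKr normrN// (le_lt_trans ht).
  by apply: hd2 => /=; rewrite opprD addNKr normrN// (le_lt_trans ht).
have dg t : `|t| <= `|h * v.1| -> is_derive t (1 : R) g ('D_(e_r R) f (q + t *: e_r R)).
  move=> ht; have [Uq _] := near_p t ht; have [dr _ _ _ _] := C1 _ Uq.
  exact: is_derive_line.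
have [th hth gE] : exists2 th, `|th| <= `|h * v.1| &
    g (h * v.1) - g 0 = 'D_(e_r R) f (q + th *: e_r R) * (h * v.1).
  have [hp|hn] := leP 0 (h * v.1).
    have [|th th0 ->] := @is_derive_MVT R g
      (fun t => 'D_(e_r R) f (q + t *: e_r R)) 0 (h * v.1) hp.
    - by move=> t t0; apply: dg; rewrite !ger0_norm//; lra.
    - exists th; last by rewrite subr0.
      by rewrite !ger0_norm//; lra.
  have [|th th0 ge] := @is_derive_MVT R g
    (fun t => 'D_(e_r R) f (q + t *: e_r R)) (h * v.1) 0 (ltW hn).
    by move=> t t0; apply: dg; rewrite !ler0_norm//; lra.
  exists th; first by rewrite !ler0_norm//; lra.
  by rewrite -[LHS]opprB ge sub0r mulrN opprK.
have [_ hth2] := near_p _ hth.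
have fE : f (h *: v + p) = g (h * v.1).
  by rewrite /g qt; congr f; rewrite addrC (surjective_pairing p); congr pair.
have := hd3 _ hv23; rewrite add0r scale0r addr0.
have -> : p + (h * v.2) *: e_z R = q + 0 *: e_r R.
  rewrite qt /e_z (surjective_pairing p); congr pair;
    by rewrite /= /GRing.scale/= ?mulr0 ?mulr1.
rewrite -/(g 0) => h3.
rewrite fE /GRing.scale/=.
have -> : l - h^-1 * (g (h * v.1) - f p) =
   - ((g (h * v.1) - g 0 - 'D_(e_r R) f p * (h * v.1)) +
      (g 0 - f p - 'D_(e_z R) f p * (h * v.2))) / h.
  by rewrite /l; field.
rewrite normrM normrN normfV ler_pdivrMr ?normr_gt0//.
rewrite (le_trans (ler_normD _ _))//.
have h1 : `|g (h * v.1) - g 0 - 'D_(e_r R) f p * (h * v.1)| <= e / (2 * B) * `|h * v.1|.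
  by rewrite gE -mulrBl normrM ler_wpM2r.
rewrite (le_trans (lerD h1 h3))// !normrM.
have e1 : e / (2 * B) * B = e / 2 by field; rewrite gt_eqF.
have := ler_wpM2l (ltW eB) v1B; have := ler_wpM2l (ltW eB) v2B; rewrite e1.
have hh : 0 <= `|h| by [].
by nra.
Qed.

End directional.


Section normal_derivative.
Context {R : realType}.
Implicit Types (f : R * R -> R) (p v : R * R) (t : R) (E : set (R * R)).

Lemma within_continuous_eps (S : set (R * R)) f p e :
  {within S, continuous f} -> S p -> 0 < e ->
  exists2 d, 0 < d & forall q, S q -> `|p.1 - q.1| < d -> `|p.2 - q.2| < d ->
    `|f q - f p| <= e.
Proof.
move=> cf Sp e0; have := cf p => /cvgrPdist_le/(_ e e0).
rewrite /nbhs/= -nbhs_subspace_in// /within/= => /nbhs_ballP[d /= d0 hd].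
by exists d => // q Sq q1 q2; rewrite distrC; apply: hd.
Qed.

Lemma exterior_open E : open (exterior E).
Proof.
apply: openI; last exact/closed_openC/closed_closure.
rewrite (_ : [set x | _] = fst @^-1` [set r : R | 0 < r]); last by [].
by apply: open_comp => [x _|]; [exact: cvg_fst|exact: open_gt].
Qed.

(** By the mean value theorem the difference quotient at h is a value of [dphi] between 0 and h. *)
Lemma right_derivative_of_limit (phi dphi : R -> R) (l d : R) : 0 < d ->
  (forall t, 0 < t < d -> is_derive t (1 : R) phi (dphi t)) ->
  phi t @[t --> (0 : R)^'+] --> phi 0 ->
  dphi t @[t --> (0 : R)^'+] --> l ->
  h^-1 * (phi h - phi 0) @[h --> (0 : R)^'+] --> l.
Proof.
move=> d0 dphiE phi0 dphil; apply/cvgrPdist_le => e e0.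
move/cvgrPdist_le : dphil => /(_ e e0) [d1 /= d10 hd1].
near=> h.
have h0 : 0 < h by [].
have hd : h < d by near: h; exact: nbhs_right_lt.
have hd1' : h < d1 by near: h; exact: nbhs_right_lt.
have [t] : exists2 t, t \in `]0, h[ & phi h - phi 0 = dphi t * (h - 0).
  apply: MVT => // [t|].
    by rewrite in_itv/= => th; apply: dphiE; lra.
  apply/continuous_within_itvP => //; split=> //.
    move=> t; rewrite in_itv/= => th.
    by apply: (@is_derive_continuous _ _ (dphi t)); apply: dphiE; lra.
  apply: cvg_at_left_filter.
  by apply: (@is_derive_continuous _ _ (dphi h)); apply: dphiE; lra.
rewrite in_itv/= subr0 => /andP[t0 th] ->.
rewrite mulrC mulfK ?gt_eqF//; apply: hd1 => //=.
by rewrite sub0r normrN gtr0_norm// (lt_trans th).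
Unshelve. all: by end_near. Qed.

Lemma is_derive_right (f : R -> R) (l : R) : is_derive (0 : R) (1 : R) f l ->
  h^-1 * (f h - f 0) @[h --> (0 : R)^'+] --> l.
Proof.
move=> df; apply/cvgrPdist_le => e e0.
have [d d0 hd] := is_derive_approx df e0.
near=> h.
have h0 : 0 < h by [].
have hlt : `|h| < d by rewrite gtr0_norm//; near: h; exact: nbhs_right_lt.
have := hd _ hlt; rewrite add0r => hf.
rewrite distrC (_ : _ - l = (f h - f 0 - l * h) / h); last by field; rewrite gt_eqF.
by rewrite normrM normfV ler_pdivrMr ?normr_gt0 ?gt_eqF.
Unshelve. all: by end_near. Qed.

Lemma within_continuous_ray (S : set (R * R)) f p v (d0 : R) :
  {within S, continuous f} -> S p -> 0 < d0 ->
  (forall t, 0 < t < d0 -> S (p + t *: v)) ->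
  f (p + t *: v) @[t --> (0 : R)^'+] --> f p.
Proof.
move=> cf Sp d00 ray; apply/cvgrPdist_le => e e0.
have [d d_gt0 hd] := within_continuous_eps cf Sp e0.
have B0 : 0 < `|v.1| + `|v.2| + 1 by rewrite ltr_wpDl// addr_ge0.
near=> t.
have t0 : 0 < t by [].
have td0 : t < d0 by near: t; exact: nbhs_right_lt.
have tB : t * (`|v.1| + `|v.2| + 1) < d.
  by rewrite -ltr_pdivlMr//; near: t; apply: nbhs_right_lt; rewrite divr_gt0.
have v1 := normr_ge0 v.1; have v2 := normr_ge0 v.2.
rewrite distrC; apply: hd; first by apply: ray; rewrite t0.
- rewrite /= opprD addNKr normrN normrM (gtr0_norm t0).
  by apply: le_lt_trans tB; rewrite ler_pM2l//; lra.
- rewrite /= opprD addNKr normrN normrM (gtr0_norm t0).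
  by apply: le_lt_trans tB; rewrite ler_pM2l//; lra.
Unshelve. all: by end_near. Qed.

(** [lim] is meaningful only once the limit is known to exist. Here it does because the gradient
    extends continuously to the boundary along the normal ray. *)
Lemma normal_deriv_cvg E c L psi s : cross_section E -> boundary_param E c L ->
  classical_regularity E psi ->
  exists l : R, h^-1 * (psi (c s + h *: normal c s) - psi (c s))
    @[h --> (0 : R)^'+] --> l.
Proof.
move=> HE Hc Hpsi.
have [C1 _ _] := cr_C2 Hpsi; have [G [cG GE]] := cr_C1 Hpsi.
set n := normal c s.
have [Kc nE] : boundary E (c s) by rewrite -(bp_range Hc); exists s.
have c10 : 0 < (c s).1 by exact: (cs_half_plane HE Kc).
have [d0 d00 hout] : exists2 d, 0 < d & forall t, 0 < t < d -> exterior E (c s + t *: n).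
  have [d1 /= d10 hd1] := @bp_outward _ _ _ _ Hc s.
  have n1 : 0 < `|n.1| + 1 by rewrite ltr_wpDl.
  (* The second bound keeps the ray in the half-plane r > 0. *)
  exists (Num.min d1 ((c s).1 / (`|n.1| + 1))); first by rewrite lt_min d10 divr_gt0.
  move=> t; rewrite lt_min => /and3P[t0 td1]; rewrite ltr_pdivlMr// => tc.
  split=> /=; last by apply: hd1 => //=; rewrite sub0r normrN gtr0_norm.
  have : - (t * n.1) <= t * `|n.1|.
    by rewrite -mulrN ler_wpM2l ?(ltW t0)// -normrN ler_norm.
  by rewrite /GRing.scale/=; lra.
have subE : E° `<=` closure E by move=> p /interior_subset/subset_closure.
have inS t : 0 < t < d0 -> ([set x : R * R | 0 < x.1] `\` E°) (c s + t *: n).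
  by move=> /hout[p0 np]; split=> // /subE.
pose phi t := psi (c s + t *: n).
pose dphi t := (G (c s + t *: n)).1 * n.1 + (G (c s + t *: n)).2 * n.2.
exists ((G (c s)).1 * n.1 + (G (c s)).2 * n.2).
rewrite (_ : psi (c s) = phi 0); last by rewrite /phi scale0r addr0.
apply: (@right_derivative_of_limit phi dphi _ d0) => //.
- move=> t td; have xt := hout _ td.
  have dp := C1_is_derive n (@exterior_open E) C1 xt.
  have [dp1 dp2] := dp.
  have := is_derive_line dp1; rewrite dp2 /dphi (GE _ xt); exact.
- have -> : phi 0 = psi (c s) by rewrite /phi scale0r addr0.
  apply: (within_continuous_ray (cr_continuous Hpsi) _ d00).
    by split => //=; exact: ltW.
  by move=> t /inS[/= p0 np]; split => //=; exact: ltW.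
- have Sc : ([set x : R * R | 0 < x.1] `\` E°) (c s) by [].
  have c1 : {within [set x : R * R | 0 < x.1] `\` E°, continuous (fun p => (G p).1)}.
    by move=> p; apply: (continuous_cvg _ cvg_fst (cG p)).
  have c2 : {within [set x : R * R | 0 < x.1] `\` E°, continuous (fun p => (G p).2)}.
    by move=> p; apply: (continuous_cvg _ cvg_snd (cG p)).
  apply: cvgD; apply: cvgM; try exact: cvg_cst.
  + exact: (within_continuous_ray c1 Sc d00 inS).
  + exact: (within_continuous_ray c2 Sc d00 inS).
Qed.

(** Convergence of the quotient for psi is what allows the limit to be split; the quadratic term is
    differentiated directly. *)
Lemma normal_deriv_relative_stream E c L psi W s :
  cross_section E -> boundary_param E c L -> classical_regularity E psi ->
  normal_deriv c (relative_stream W psi) s =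
  normal_deriv c psi s - W * (c s).1 * (normal c s).1.
Proof.
move=> HE Hc Hpsi; have [l hl] := normal_deriv_cvg s HE Hc Hpsi.
rewrite /normal_deriv /ext_deriv.
have -> : lim (h^-1 * (psi (c s + h *: normal c s) - psi (c s)) @[h --> 0^'+]) = l.
  exact: cvg_lim hl.
apply: cvg_lim => //.
rewrite (_ : (fun h => _) = (fun h =>
  h^-1 * (psi (c s + h *: normal c s) - psi (c s)) -
  h^-1 * (W / 2 * (c s + h *: normal c s).1 ^+ 2 - W / 2 * (c s).1 ^+ 2))); last first.
  by apply/funext => h; rewrite /relative_stream; ring.
apply: cvgB => //.
have dq : is_derive (0 : R) (1 : R)
    (fun h : R => W / 2 * ((c s).1 + h * (normal c s).1) ^+ 2)
    (W * (c s).1 * (normal c s).1).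
  by apply: is_derive_eq; rewrite /GRing.scale/=; field.
by have := is_derive_right dq; rewrite mul0r addr0.
Qed.

End normal_derivative.


(** * Elementary inequalities behind the final bound *)

Lemma aspect_ge (R : realType) (s M w h : R) : 0 < s -> 0 < w -> 0 < h ->
  s ^+ 2 <= h * w -> h * w ^+ 2 / 32 <= M ->
  (w + h) * s <= 2 ^+ 15 * h ^+ 2 * (M / s ^+ 3 + (M / s ^+ 3) ^+ 3).
Proof.
(* With u = w / s, the area bound gives s <= h u and w <= u^2 h, so the left side is at most h^2 (u
   + u^3). The moment bound gives u <= 32 mu, and 2^15 = 32^3 covers both powers. *)
move=> s0 w0 h0 shw hM; set mu := M / s ^+ 3; pose u := w / s.
have u0 : 0 < u by rewrite divr_gt0.
have wE : w = u * s by rewrite /u divfK ?gt_eqF.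
have sh : s <= h * u.
  by rewrite /u mulrA ler_pdivlMr// -expr2.
have umu : u <= 32 * mu.
  rewrite /mu mulrA ler_pdivlMr ?exprn_gt0//.
  have -> : u * s ^+ 3 = w * s ^+ 2 by rewrite wE; ring.
  have : w * s ^+ 2 <= w * (h * w) by rewrite ler_pM2l.
  lra.
have mu0 : 0 < mu by lra.
have u3 : u ^+ 3 <= (32 * mu) ^+ 3 by rewrite lerXn2r ?nnegrE// ?ltW// mulr_gt0.
have h2 : 0 < h ^+ 2 by rewrite exprn_gt0.
apply: (@le_trans _ _ (h ^+ 2 * (u + u ^+ 3))).
  have ws : w <= u ^+ 2 * h.
    by rewrite wE expr2 -mulrA ler_pM2l// mulrC.
  apply: (@le_trans _ _ ((u ^+ 2 * h + h) * (h * u))).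
    by apply: ler_pM => //; [lra|exact: ltW|rewrite lerD2r].
  by rewrite le_eqVlt; apply/orP; left; apply/eqP; ring.
have -> : 2 ^+ 15 * h ^+ 2 * (mu + mu ^+ 3) =
  h ^+ 2 * (2 ^+ 15 * mu + (32 * mu) ^+ 3) by ring.
rewrite ler_pM2l//.
apply: lerD => //; apply: (le_trans umu).
rewrite ler_pM2r// (_ : 2 ^+ 15 = 32 * 1024); last by ring.
lra.
Qed.

(* s is the square root of the area, M and J are the integrals of r and r^-2
   over E, so that mu = M / s^3; w and 2 Z are the sides of the bounding box. *)
Lemma weber_lower_bound (R : realType) (c sigma rho lambda L s M J w Z beta p : R) :
  0 < c -> 0 < sigma -> 0 < rho -> 0 < L -> 0 < s -> 0 < w -> 0 < Z -> 0 < p ->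
  s ^+ 2 <= 2 * Z * w -> Z * w ^+ 2 / 16 <= M -> s ^+ 6 <= J * M ^+ 2 ->
  L <= 2 * w + 4 * Z -> 0 <= J - 2 * p ->
  2 * sigma * (J - 2 * p + p) <= lambda * L ->
  4 * Z ^+ 2 * lambda <= rho * beta ^+ 2 ->
  c / 2 ^+ 16 / (M / s ^+ 3 + (M / s ^+ 3) ^+ 3) *
    (((M / s ^+ 3) ^+ 2)^-1 + (J - 2 * p)) <= c * rho * beta ^+ 2 / (sigma * s).
Proof.
move=> c0 sg0 r0 L0 s0 w0 Z0 p0 sZw hM hJ hL d0 hlam hbeta.
have h0 : 0 < 2 * Z by lra.
have hM' : 2 * Z * w ^+ 2 / 32 <= M by lra.
have asp := aspect_ge s0 w0 h0 sZw hM'.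
have M0 : 0 < M by apply: lt_le_trans hM; rewrite divr_gt0// mulr_gt0// exprn_gt0.
set mu := M / s ^+ 3 in asp *.
have mu0 : 0 < mu by rewrite divr_gt0// exprn_gt0.
have muJ : (mu ^+ 2)^-1 <= J.
  have M2 : 0 < M ^+ 2 by rewrite exprn_gt0.
  have -> : (mu ^+ 2)^-1 = s ^+ 6 / M ^+ 2.
    by rewrite /mu; field; rewrite !gt_eqF.
  by rewrite ler_pdivrMr.
set D := J - 2 * p + p in hlam.
have D0 : 0 < D by rewrite /D; lra.
have mm0 : 0 < mu + mu ^+ 3 by rewrite addr_gt0// exprn_gt0.
(* Jensen bounds mu^-2 by J, and J + (J - 2 p) is exactly 2 D; this factor 2 turns 2^15 into
   2^16. *)
apply: (@le_trans _ _ (c / 2 ^+ 16 / (mu + mu ^+ 3) * (2 * D))).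
  by rewrite ler_pM2l ?divr_gt0//; rewrite /D; lra.
have lamL : 4 * Z ^+ 2 * (2 * sigma * D) <= rho * beta ^+ 2 * (2 * w + 4 * Z).
  have wZ : 0 < 2 * w + 4 * Z by lra.
  have lam0 : 0 <= lambda.
    by rewrite -(pmulr_lge0 _ L0); apply: le_trans hlam; rewrite !mulr_ge0// ltW.
  have h1 : lambda * L <= lambda * (2 * w + 4 * Z) by rewrite ler_wpM2l.
  apply: (@le_trans _ _ (4 * Z ^+ 2 * lambda * (2 * w + 4 * Z))); last first.
    by rewrite ler_pM2r.
  have Z2 : 0 <= 4 * Z ^+ 2 by rewrite mulr_ge0// sqr_ge0.
  by rewrite -[leRHS]mulrA ler_wpM2l// (le_trans hlam).
rewrite ler_pdivlMr ?mulr_gt0//.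
have wh0 : 0 < w + 2 * Z by lra.
have asp' : (w + 2 * Z) * s / (2 ^+ 15 * (2 * Z) ^+ 2) <= mu + mu ^+ 3.
  have B0 : 0 < 2 ^+ 15 * (2 * Z) ^+ 2 by rewrite mulr_gt0// exprn_gt0.
  by rewrite ler_pdivrMr// [leRHS]mulrC.
have -> : c / 2 ^+ 16 / (mu + mu ^+ 3) * (2 * D) * (sigma * s) =
    c * (sigma * D * s / 2 ^+ 15) / (mu + mu ^+ 3).
  by field; rewrite gt_eqF.
rewrite ler_pdivrMr//.
have -> : c * rho * beta ^+ 2 * (mu + mu ^+ 3) =
  c * (rho * beta ^+ 2 * (mu + mu ^+ 3)) by ring.
rewrite ler_pM2l//.
apply: (@le_trans _ _ (rho * beta ^+ 2 *
    ((w + 2 * Z) * s / (2 ^+ 15 * (2 * Z) ^+ 2)))); last first.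
  by rewrite ler_wpM2l// mulr_ge0 ?sqr_ge0// ltW.
have t0 : 0 < s / (2 * 2 ^+ 15 * (2 * Z) ^+ 2).
  by rewrite divr_gt0// !mulr_gt0// exprn_gt0.
have := lamL; rewrite -(ler_pM2r t0).
by congr (_ <= _); field; rewrite gt_eqF.
Qed.


(** * Integrating the dynamic condition over the loop *)

Section bubble.
Context {R : realType} (E : set (R * R)) (x y x1 y1 k : R -> R) (L : R).
Hypothesis H : convex_loop E x y x1 y1 k L.
Context (a b Z s0 m s1 m' : R).
Hypothesis Q : loop_quadrants E x y x1 y1 L a b Z s0 m s1 m'.

Let L0 : 0 < L. Proof. exact: cl_length H. Qed.
Let x0 s : 0 < x s.
Proof. by have := cl_half H (@cl_mem _ _ _ _ _ _ _ _ H s). Qed.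
Let x1L s : x1 (s + L) = x1 s.
Proof. exact: derive_periodic (cl_dx H) (cl_xL H). Qed.
Let y1L s : y1 (s + L) = y1 s.
Proof. exact: derive_periodic (cl_dy H) (cl_yL H). Qed.

Lemma loop_curvature_periodic s : k (s + L) = k s.
Proof.
have h1 := derive_periodic s (cl_dx1 H) x1L.
have h2 := derive_periodic s (cl_dy1 H) y1L.
rewrite -[LHS]mul1r -[RHS]mul1r -(cl_unit H s).
move: h1 h2; rewrite x1L y1L !mulNr => /oppr_inj h1 h2.
by rewrite !mulrDl !expr2 -!mulrA h1 h2.
Qed.

Let cx : continuous x.
Proof. by move=> s; exact: is_derive_continuous (cl_dx H s). Qed.
Let cy1 : continuous y1.
Proof. by move=> s; exact: is_derive_continuous (cl_dy1 H s). Qed.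

Let cn : continuous (fun s => y1 s / x s).
Proof.
move=> s; apply: cvgM; first exact: cy1.
by apply: cvgV; [rewrite gt_eqF|exact: cx].
Qed.

Let J := plane_integral E (fun p => (p.1 ^+ 2)^-1).

Lemma loop_primitives : exists FK FN : R -> R,
  [/\ forall s : R, 0 <= s -> is_derive s (1 : R) FK (k s),
      forall s : R, 0 <= s -> is_derive s (1 : R) FN (y1 s / x s)
    & line_integral L (fun s => k s + y1 s / x s) =
        (FK (s0 + L) - FK s0) + (FN (s0 + L) - FN s0)].
Proof.
have [h0 h1 h2 h3 h4] := lq_order Q.
have [FK [dK _ _]] := line_integral_primitive L0 (cl_k H) loop_curvature_periodic.
have pn s : y1 (s + L) / x (s + L) = y1 s / x s by rewrite y1L (cl_xL H).
have [FN [dN _ _]] := line_integral_primitive L0 cn pn.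
have cH : continuous (fun s => k s + y1 s / x s).
  by move=> s; apply: cvgD; [exact: (cl_k H)|exact: cn].
have pH s : k (s + L) + y1 (s + L) / x (s + L) = k s + y1 s / x s.
  by rewrite loop_curvature_periodic pn.
have [FH [dH _ iH]] := line_integral_primitive L0 cH pH.
exists FK, FN; split => //.
rewrite (iH s0 h0).
have sL : s0 <= s0 + L by lra.
have dKN (s : R) : s0 <= s <= s0 + L ->
    is_derive s (1 : R) (fun s => FK s + FN s) (k s + y1 s / x s).
  by move=> hs; apply: is_deriveD; [apply: dK|apply: dN]; lra.
rewrite (@derive_eq R FH (fun s => k s + y1 s / x s) _ _ _ _ sL _ dKN) //.
  ring.
by move=> s hs; apply: dH; lra.
Qed.

Lemma bubble_estimate (q : R -> R) (sigma rho lambda : R) :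
  plane_convex E -> 0 < sigma -> 0 < rho -> continuous q ->
  (forall s, q (s + L) = q s) -> (forall s, q s <= 0) ->
  (forall s, 2 * sigma * (k s + y1 s / x s) - rho * q s ^+ 2 + lambda = 0) ->
  line_integral L (fun s => k s + y1 s / x s) <= 0 ->
  [/\ 0 <= J - 2 * pi, 2 * sigma * (J - 2 * pi + pi) <= lambda * L &
    4 * Z ^+ 2 * lambda <= rho * (line_integral L q) ^+ 2].
Proof.
move=> cE sg0 r0 cq pq q0 dyn.
have [h0 h1 h2 h3 h4] := lq_order Q.
have [FK [FN [dK dN ->]]] := loop_primitives.
have [K1 K2 K3] := loop_curvature H Q dK.
have JE : J = 2 * \int[@lebesgue_measure R]_(r in `[a, b])
    slice_density E a b (fun r => (r ^+ 2)^-1) r.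
  have a0 : 0 < a by case/andP: (lq_ab Q).
  apply: (@plane_integral_slices _ _ _ _ _ _ _ _ H _ _ _ _ _ _ _ Q (fun r => (r ^+ 2)^-1)).
    move=> r /andP[ar _]; have rn0 : r != 0 by rewrite gt_eqF// (lt_le_trans a0).
    by apply: cvgV; [rewrite sqrf_eq0|exact: exprn_continuous].
  by move=> r _; rewrite invr_ge0 sqr_ge0.
rewrite (green_inverse H Q dN) -JE K3 => hJ.
have d0 : 0 <= J - 2 * pi by lra.
(* S is a primitive of rho q^2; its increase over the arcs where the normal
   points to r > 0 is at least 2 sigma times their total curvature pi. *)
pose S s := 2 * sigma * (FK s + FN s) + lambda * s.
have dS (s : R) : 0 <= s -> is_derive s (1 : R) S (rho * q s ^+ 2).
  move=> hs; have dKs := dK s hs; have dNs := dN s hs.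
  have <- : 2 * sigma * (k s + y1 s / x s) + lambda = rho * q s ^+ 2.
    by have := dyn s; lra.
  by apply: is_derive_eq; rewrite /GRing.scale/=; ring.
have S_mono (s t : R) : 0 <= s -> s <= t -> S s <= S t.
  move=> hs st; apply: (@derive_ge0_le R S (fun u => rho * q u ^+ 2) s t st) => u hu.
    by apply: dS; lra.
  by rewrite mulr_ge0 ?sqr_ge0// ltW.
have SL : S (s0 + L) - S s0 = lambda * L - 2 * sigma * (J - 2 * pi).
  have := green_inverse H Q dN; rewrite -JE /S => e.
  by have := K3; nra.
have lamL : 0 <= lambda * L.
  have : S s0 <= S (s0 + L) by apply: S_mono => //; lra.
  have : 0 <= 2 * sigma * (J - 2 * pi) by rewrite mulr_ge0// mulr_ge0// ltW.
  by have := SL; lra.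
have lam0 : 0 <= lambda by rewrite -(pmulr_lge0 _ L0).
have arc (s t : R) : 0 <= s -> s <= t -> (forall u, s <= u <= t -> 0 <= y1 u) ->
    2 * sigma * FK t - 2 * sigma * FK s <= S t - S s.
  move=> hs st y0.
  have dFK (u : R) : s <= u <= t -> is_derive u (1 : R) (fun u => 2 * sigma * FK u)
      (2 * sigma * k u).
    move=> hu; have dKu : is_derive u (1 : R) FK (k u) by apply: dK; lra.
    by apply: is_derive_eq; rewrite /GRing.scale/=; ring.
  have dSu (u : R) : s <= u <= t -> is_derive u (1 : R) S (rho * q u ^+ 2).
    by move=> hu; apply: dS; lra.
  apply: (@derive_le R (fun u => 2 * sigma * FK u) _ S _ s t st dFK dSu) => u hu.
  have n0 : 0 <= 2 * sigma * (y1 u / x u).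
    apply: mulr_ge0; first by rewrite mulr_ge0// ltW.
    by apply: divr_ge0; [exact: y0|exact: ltW].
  by have := dyn u; lra.
have y1I u : s0 <= u <= m -> 0 <= y1 u by move=> /(lq_I Q)/andP[].
have y1IV u : m' <= u <= s0 + L -> 0 <= y1 u by move=> /(lq_IV Q)/andP[].
split => //.
  have arcI := arc _ _ h0 (ltW h1) y1I.
  have m'0 : 0 <= m' by lra.
  have arcIV := arc _ _ m'0 (ltW h4) y1IV.
  (* On the inner arcs n.e_r / r is nonpositive and may outweigh the curvature, so only rho q^2 >= 0
     is used there. *)
  have mid : S m <= S m' by apply: S_mono; lra.
  have e1 : 2 * sigma * FK m - 2 * sigma * FK s0 = sigma * pi.
    by rewrite -mulrBr K1; field.
  have e2 : 2 * sigma * FK (s0 + L) - 2 * sigma * FK m' = sigma * pi.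
    by rewrite -mulrBr K2; field.
  by move: arcI arcIV SL; rewrite e1 e2; lra.
have [F [dF _ iF]] := line_integral_primitive L0 cq pq.
rewrite (iF s0 h0).
pose v := Num.sqrt (lambda / rho).
have v0 : 0 <= v by exact: sqrtr_ge0.
have v2 : v ^+ 2 = lambda / rho by rewrite sqr_sqrtr// divr_ge0// ltW.
have F_mono (s t : R) : 0 <= s -> s <= t -> F t <= F s.
  move=> hs st; rewrite -subr_le0 -[leRHS](subrr (0 : R)).
  apply: (@derive_le R F q (fun=> 0) (fun=> 0) s t st) => u hu //.
  by apply: dF; lra.
(* On the outer arcs both terms of the ring curvature are nonnegative, so rho q^2 >= lambda; as q <=
   0 this means q <= - v. *)
have outer (s t : R) : 0 <= s -> s <= t -> (forall u, s <= u <= t -> 0 <= y1 u) ->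
    F t - F s <= - v * t - - v * s.
  move=> hs st y0; apply: (@derive_le R F q (fun u => - v * u) (fun=> - v) s t st) => u hu.
  - by apply: dF; lra.
  - by apply: is_derive_eq; rewrite /GRing.scale/= mulr1.
  have n0 : 0 <= 2 * sigma * (k u + y1 u / x u).
    apply: mulr_ge0; first by rewrite mulr_ge0// ltW.
    apply: addr_ge0; first exact: (loop_curvature_ge0 H).
    by apply: divr_ge0; [exact: y0|exact: ltW].
  have : v ^+ 2 <= (- q u) ^+ 2.
    rewrite v2 ler_pdivrMr// sqrrN mulrC.
    by have := dyn u; lra.
  rewrite ler_pXn2r ?nnegrE ?oppr_ge0//.
  by lra.
have o1 := outer _ _ h0 (ltW h1) y1I.
have m'0 : 0 <= m' by lra.
have o2 := outer _ _ m'0 (ltW h4) y1IV.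
have o3 : F m' <= F m by apply: F_mono; lra.
have ol := loop_outer_length H Q.
have hv : 2 * Z * v <= - (F (s0 + L) - F s0).
  have := ler_wpM2l v0 ol; lra.
have Z0 := lq_Z Q.
have : (2 * Z * v) ^+ 2 <= (- (F (s0 + L) - F s0)) ^+ 2.
  have z0 : 0 <= 2 * Z * v by rewrite mulr_ge0// mulr_ge0// ltW.
  by rewrite lerXn2r ?nnegrE// (le_trans z0).
rewrite sqrrN exprMn v2 => /(ler_wpM2l (ltW r0)); apply: le_trans.
rewrite le_eqVlt; apply/orP; left; apply/eqP.
by field; rewrite gt_eqF.
Qed.

End bubble.

Theorem theorem1 (R : realType) :
  exists C : R, 0 < C /\
    forall (sigma rho : R) (E : set (R * R)) (c : R -> R * R) (L : R)
           (psi : R * R -> R) (W gamma lambda : R),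
      0 < sigma -> 0 < rho ->
      cross_section E -> boundary_param E c L ->
      bubble_ring sigma rho E c psi W gamma lambda ->
      line_integral L (ring_curvature c) <= 0 ->
      (forall s : R, normal_deriv c (relative_stream W psi) s <= 0) ->
      C / (aspect E + aspect E ^+ 3) * ((aspect E ^+ 2)^-1 + delta E)
        <= weber sigma rho E c L psi.
Proof.
have c0 : 0 < Num.sqrt (2 * pi) :> R by rewrite sqrtr_gt0 mulr_gt0// pi_gt0.
(* The root is the normalization in [weber]; 2^16 is twice 32^3, which comes from cubing w / sqrt
   |E| <= 32 mu. *)
exists (Num.sqrt (2 * pi) / 2 ^+ 16); split.
  by rewrite divr_gt0// exprn_gt0.
move=> sigma rho E c L psi W gamma lambda sg0 r0 HE Hc Hb hH hn.
have H := boundary_param_loop HE Hc.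
have [a [b [Z [s0 [m [s1 [m' Q]]]]]]] := loop_quadrants_exist H.
have cE := convex_set_plane (cs_convex HE).
have x0 s : 0 < (c s).1 by have := cl_half H (@cl_mem _ _ _ _ _ _ _ _ H s).
pose k := curvature c.
pose y1 s := (derive1 c s).2.
pose q s := (c s).1^-1 * normal_deriv c psi s - W * y1 s.
have dotE s : dot (normal c s) (e_r R) = y1 s.
  by rewrite /dot /normal /e_r /= mulr1 mulr0 addr0.
have dyn s : 2 * sigma * (k s + y1 s / (c s).1) - rho * q s ^+ 2 + lambda = 0.
  by have := br_dynamic Hb s; rewrite ring_curvatureE dotE.
(* Multiplied by r, q becomes the normal derivative of the relative stream function. *)
have q0 s : q s <= 0.
  have := hn s; rewrite (normal_deriv_relative_stream _ _ HE Hc (br_regular Hb)).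
  move=> h; rewrite -(pmulr_rle0 _ (x0 s)) /q mulrBr mulVKf ?gt_eqF//.
  by rewrite mulrCA mulrA.
(* Since q <= 0, the dynamic condition determines q from its square; continuity and periodicity are
   then inherited from the curve and its curvature. *)
have qE : q = (fun s => - Num.sqrt ((2 * sigma * (k s + y1 s / (c s).1) + lambda) / rho)).
  apply/funext => s; have rn0 : rho != 0 by rewrite gt_eqF.
  have -> : 2 * sigma * (k s + y1 s / (c s).1) + lambda = rho * q s ^+ 2.
    by have := dyn s; lra.
  by rewrite mulrC mulKf// sqrtr_sqr ler0_norm ?opprK.
have cx : continuous (fun s => (c s).1).
  by move=> s; exact: is_derive_continuous (cl_dx H s).
have cy1 : continuous y1.
  by move=> s; exact: is_derive_continuous (cl_dy1 H s).
have cq : continuous q.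
  rewrite qE => s; apply: cvgN; apply: (continuous_cvg _ (@sqrt_continuous _ _)).
  apply: cvgM; last exact: cvg_cst.
  apply: cvgD; last exact: cvg_cst.
  apply: cvgM; first exact: cvg_cst.
  apply: cvgD; first exact: (cl_k H).
  apply: cvgM; first exact: cy1.
  by apply: cvgV; [rewrite gt_eqF|exact: cx].
have y1L s : y1 (s + L) = y1 s.
  exact: derive_periodic (cl_dy H) (cl_yL H).
have pq s : q (s + L) = q s.
  by rewrite qE /k (loop_curvature_periodic H) y1L (bp_periodic Hc).
(* The integrand exceeds q by W y1, the derivative of W z along the closed curve, which integrates
   to zero. *)
have circ : circulation c L psi = - line_integral L q.
  rewrite /circulation; congr (- _).
  rewrite (_ : (fun s => _) = (fun s => q s + W * y1 s)); last first.
    by apply/funext => s; rewrite /q subrK.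
  have cqW : continuous (fun s => q s + W * y1 s).
    by move=> s; apply: cvgD; [exact: cq|apply: cvgM; [exact: cvg_cst|exact: cy1]].
  have pqW s : q (s + L) + W * y1 (s + L) = q s + W * y1 s by rewrite pq y1L.
  have L0 := cl_length H.
  have [F [dF FL _]] := line_integral_primitive L0 cqW pqW.
  have [F' [dF' FL' _]] := line_integral_primitive L0 cq pq.
  have dG (s : R) : 0 <= s <= L ->
      is_derive s (1 : R) (fun s => F' s + W * (c s).2) (q s + W * y1 s).
    move=> /andP[hs _]; have dFs := dF' s hs; have dys := cl_dy H s.
    by apply: is_derive_eq; rewrite /GRing.scale.
  have dF0 (s : R) : 0 <= s <= L -> is_derive s (1 : R) F (q s + W * y1 s).
    by move=> /andP[hs _]; exact: dF.
  rewrite FL FL' (derive_eq (ltW L0) dF0 dG)// -[L in (c L).2]add0r.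
  by rewrite (cl_yL H); ring.
have hH' : line_integral L (fun s => k s + y1 s / (c s).1) <= 0.
  rewrite (_ : (fun s => _) = ring_curvature c)//.
  by apply/funext => s; rewrite ring_curvatureE.
have [d0 hlam hbeta] := bubble_estimate H Q cE sg0 r0 cq pq q0 dyn hH'.
have [A0 hA hM hJ] := section_moments H Q cE.
have hL := loop_length H Q.
have /andP[_ ab] := lq_ab Q.
set s := Num.sqrt (area E).
have ss0 : 0 < s by rewrite sqrtr_gt0.
have sA : s ^+ 2 = area E by rewrite sqr_sqrtr// ltW.
rewrite /weber circ sqrrN.
have -> : aspect E = plane_integral E (fun p => p.1) / s ^+ 3.
  rewrite /aspect /major_radius -/s -sA; field; rewrite gt_eqF//.
apply: (@weber_lower_bound R _ sigma rho lambda L s _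
  (plane_integral E (fun p => (p.1 ^+ 2)^-1)) (b - a) Z _ pi) => //.
- exact: cl_length H.
- by rewrite subr_gt0.
- exact: lq_Z Q.
- exact: pi_gt0.
- by rewrite sA.
- by rewrite -[6%N]/(2 * 3)%N exprM sA.
Qed.
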